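(* Let $\sigma:\mathfrak X\times\Omega\times[0,\tau]\to\mathbb C$ be a measurable function such that there exist a function $v\in L^2(\mathfrak X)$ and a positive constant $C$ for which $$\bigl|q^{\frac12h_\omega(x)}\sigma(x,\omega,s)\bigr|\le C|v(x)|$$ for all $x\in\mathfrak X$ and almost all $(\omega,s)\in\Omega\times[0,\tau]$. Then $T_\sigma:L^2(\mathfrak X)\to L^2(\mathfrak X)$ is a bounded linear operator. Moreover, $\|T_\sigma\|_{B(L^2(\mathfrak X))}\le C'\|v\|_{L^2(\mathfrak X)}$ for some constant $C'$.
   Context: Let $q\ge 2$ be an integer and let $\mathfrak X$ be (the vertex set of) the homogeneous tree of degree $q+1$: the connected graph without loops (cycles) in which every vertex has exactly $q+1$ neighbours. $d(x,y)$ is the number of edges of the geodesic from $x$ to $y$; a reference vertex $o$ is fixed and $|x|=d(o,x)$. $\mathfrak X$ carries the counting measure and $L^p(\mathfrak X)$ is taken with respect to it. $\Omega$ is the set of infinite geodesic rays $\omega=(\omega_0,\omega_1,\dots)$ with $\omega_0=o$. The height function is $h_\omega(x)=\lim_{m\to\infty}(m-d(x,\omega_m))=2|c(x,\omega)|-|x|$, where $c(x,\omega)$ is the last vertex on the geodesic path $[o,x]$ that lies on $\omega$. $\nu$ is the probability measure on $\Omega$ (with the $\sigma$-algebra generated by the sets $E(x)=\{\omega:\omega\text{ passes through }x\}$) with $\nu(E(x))=\frac{q}{(q+1)q^{|x|}}$ for $x\neq o$. Put $\tau=\pi/\log q$ and $d\mu(s)=c_P|c(s)|^{-2}ds$ on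 $[0,\tau]$, with $c_P=\frac{q\log q}{2\pi(q+1)}$ and $c(z)=\frac{q^{1/2}}{q+1}\,\frac{q^{1/2+iz}-q^{-1/2-iz}}{q^{iz}-q^{-iz}}$. $\Omega\times[0,\tau]$ carries $\nu\otimes\mu$. For finitely supported $f:\mathfrak X\to\mathbb C$ the Fourier-Helgason transform is $\mathcal Hf(\omega,s)=\sum_{y\in\mathfrak X}f(y)q^{(\frac12+is)h_\omega(y)}$. For measurable $\sigma$ and finitely supported $f$, the pseudo-differential operator with symbol $\sigma$ is $T_\sigma f(x)=\int_\Omega\int_0^\tau q^{(\frac12-is)h_\omega(x)}\sigma(x,\omega,s)\mathcal Hf(\omega,s)\,d\nu(\omega)d\mu(s)$. Saying that $T_\sigma$ is an operator of a given class between $L^p$ spaces means that this integral converges absolutely for all finitely supported $f$ and all $x$, and that $T_\sigma$ extends from finitely supported functions to an operator of that class. *)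

(* Defs.v *)
From HB Require Import structures.
From mathcomp Require Import all_boot all_order all_algebra.
From mathcomp Require Import all_classical all_reals all_analysis.
From mathcomp Require Import measurable_realfun complex finmap.
Set Implicit Arguments.
Unset Strict Implicit.
Unset Printing Implicit Defensive.
Import Order.TTheory GRing.Theory Num.Theory.
Import numFieldNormedType.Exports.
Import Normc.
Local Open Scope classical_set_scope.
Local Open Scope ring_scope.
Local Open Scope complex_scope.

(* A homogeneous tree of degree q + 1, with q >= 2, together with its
   reference vertex.  A cycle is a simple closed path of length at least 3. *)
Record htree (q : nat) := HTree {
  vertex : choiceType ;
  adj : rel vertex ;
  root : vertex ;
  htree_ge2 : (2 <= q)%N ;
  adj_irr : irreflexive adj ;
  adj_sym : symmetric adj ;
  adj_connected : forall x y, exists2 p, path adj x p & y = last x p ;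
  adj_acyclic : forall p, (2 < size p)%N -> ~~ ucycleb adj p ;
  adj_regular : forall x, ([set y | adj x y] #= `I_q.+1)%card
}.
Arguments adj {q h}.
Arguments root {q}.

Definition tvertex q (X : htree q) : Type := vertex X.

HB.instance Definition _ q (X : htree q) := Choice.on (tvertex X).
HB.instance Definition _ q (X : htree q) := isPointed.Build (tvertex X) (root X).
HB.instance Definition _ q (X : htree q) :=
  @isMeasurable.Build default_measure_display (tvertex X)
    discrete_measurable discrete_measurable0
    discrete_measurableC discrete_measurableU.

Section distance.
Context {q : nat} {X : htree q}.
Implicit Types x y z : tvertex X.

Lemma walk_exists x y : exists n,
  `[< exists2 p, path adj x p & y = last x p /\ size p = n >].
Proof.
have [p xp yp] := @adj_connected q X x y.
by exists (size p); apply/asboolP; exists p.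
Qed.

Definition dist x y : nat := ex_minn (walk_exists x y).

Lemma dist_walk x y :
  exists2 p, path adj x p & y = last x p /\ size p = dist x y.
Proof. by rewrite /dist; case: ex_minnP => n /asboolP[p xp e] _; exists p. Qed.

Lemma dist_le x p : path adj x p -> (dist x (last x p) <= size p)%N.
Proof.
move=> xp; rewrite /dist; case: ex_minnP => n _; apply.
by apply/asboolP; exists p.
Qed.

Lemma dist_adj x y z : adj y z -> (dist x z <= (dist x y).+1)%N.
Proof.
move=> yz; have [p xp [yE <-]] := dist_walk x y.
have := @dist_le x (rcons p z); rewrite rcons_path xp -yE yz => /(_ isT).
by rewrite last_rcons size_rcons.
Qed.

Lemma dist_triangle x y z : (dist x z <= dist x y + dist y z)%N.
Proof.
have [p xp [yE <-]] := dist_walk x y; have [r yr [zE <-]] := dist_walk y z.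
have := @dist_le x (p ++ r); rewrite cat_path xp -yE yr => /(_ isT).
by rewrite last_cat size_cat -yE -zE.
Qed.

Lemma dist_walk_avoid x y z : (dist x y <= dist x z)%N -> y <> z ->
  exists2 p, path adj x p & y = last x p /\ z \notin x :: p.
Proof.
move=> yz nyz; have [p xp [yE pE]] := dist_walk x y; exists p => //; split => //.
apply/negP => /splitPl zp; case: zp xp yE pE => p1 p2 zE.
rewrite cat_path => /andP[xp1 _] yE pE.
have := dist_le xp1; rewrite zE => /(leq_trans yz).
rewrite -pE size_cat -[leqRHS]addn0 leq_add2l leqn0 size_eq0 => /eqP p20.
by apply: nyz; rewrite yE p20 cats0.
Qed.

Lemma nbr_unique (o x y z : tvertex X) : adj x y -> adj x z ->
  (dist o y <= dist o x)%N -> (dist o z <= dist o x)%N -> y = z.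
Proof.
move=> xy xz oy oz; apply: contrapT => yz.
have nyx : y <> x by move=> yx; move: xy; rewrite yx adj_irr.
have nzx : z <> x by move=> zx; move: xz; rewrite zx adj_irr.
have [p op [yE xp]] := dist_walk_avoid oy nyx.
have [r or [zE xr]] := dist_walk_avoid oz nzx.
pose p' := rev (belast o p).
have yp' : path adj y p'.
  rewrite yE rev_path; apply: sub_path op => u v /=.
  by rewrite adj_sym.
have lp' : last y p' = o.
  rewrite /p' yE; case: (p) => [//|a s].
  by rewrite /= rev_cons last_rcons.
have xyp' : x \notin y :: p'.
  rewrite inE negb_or; apply/andP; split; first by apply/eqP => /esym.
  by rewrite mem_rev; apply: contra xp => /mem_belast.
have [s [ys us sub zs]] : exists s, [/\ path adj y s, uniq (y :: s),
    {subset s <= p' ++ r} & z = last y s].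
  have := @shortenP _ adj y (p' ++ r).
  rewrite cat_path yp' lp' or last_cat lp' => /(_ isT).
  by rewrite zE; case=> s; exists s.
have s0 : s != [::] by apply/eqP => s0; apply: yz; rewrite zs s0.
have := @adj_acyclic q X (x :: y :: s).
rewrite /= !ltnS lt0n size_eq0 s0 => /(_ isT)/negP; apply.
apply/andP; split; last first.
  rewrite cons_uniq us andbT inE negb_or; move: xyp'.
  rewrite inE negb_or => /andP[-> xp'] /=; apply/negP => /sub.
  by rewrite mem_cat (negbTE xp') /= => xr'; rewrite inE xr' orbT in xr.
by rewrite /= xy rcons_path ys -zs adj_sym.
Qed.

Lemma nbr_farther (o x : tvertex X) :
  exists y, adj x y && (dist o y == (dist o x).+1).
Proof.
have An := @adj_regular q X x.
have /finite_fsetP[A AE] : finite_set [set y | adj x y] by exists q.+1.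
move: An; rewrite AE => /card_eq_fsetP cA.
have [y [z [nyz yA zA]]] :
    exists y z : tvertex X, [/\ y <> z, y \in enum_fset A & z \in enum_fset A].
  have : (2 < size (enum_fset A))%N by rewrite [size _]cA ltnS htree_ge2.
  have := fset_uniq A; case: (enum_fset A) => [|y [|z s]] //= + _.
  rewrite inE negb_or => /andP[/andP[/eqP nyz _] _].
  by exists y, z; split; rewrite ?inE ?eqxx ?orbT.
have xy : adj x y by have : [set` A] y by []; rewrite -AE.
have xz : adj x z by have : [set` A] z by []; rewrite -AE.
have [oy|oy] := leqP (dist o y) (dist o x); last first.
  by exists y; rewrite xy eqn_leq oy dist_adj.
have [oz|oz] := leqP (dist o z) (dist o x); last first.
  by exists z; rewrite xz eqn_leq oz dist_adj.
by have := nbr_unique xy xz oy oz.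
Qed.

End distance.

(* Infinite geodesic rays issued from the reference vertex. *)
Record ray q (X : htree q) := Ray {
  ray_fun :> nat -> tvertex X ;
  ray_root : ray_fun 0 = root X ;
  ray_geodesic :
    forall m n, (m <= n)%N -> dist (ray_fun m) (ray_fun n) = (n - m)%N
}.

HB.instance Definition _ q (X : htree q) := gen_eqMixin (ray X).
HB.instance Definition _ q (X : htree q) := gen_choiceMixin (ray X).

Lemma ray_exists q (X : htree q) : exists _ : ray X, True.
Proof.
pose w n : tvertex X :=
  iter n (fun x => xchoose (nbr_farther (root X : tvertex X) x)) (root X).
have w1 n : adj (w n) (w n.+1) && (dist (root X) (w n.+1) == (dist (root X) (w n)).+1).
  exact: (xchooseP (nbr_farther (root X : tvertex X) (w n))).
have d0 (x : tvertex X) : dist x x = 0%N.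
  by apply/eqP; rewrite -leqn0; exact: (@dist_le _ _ x [::]).
have dw n : dist (root X) (w n) = n.
  by elim: n => [|n IH]; [exact: d0|have /andP[_ /eqP ->] := w1 n; rewrite IH].
suff gw m n : (m <= n)%N -> dist (w m) (w n) = (n - m)%N.
  by exists (@Ray _ X w erefl gw).
move=> mn; apply/eqP; rewrite eqn_leq; apply/andP; split; last first.
  by have := dist_triangle (root X) (w m) (w n); rewrite !dw leq_subLR.
rewrite -{1}(subnKC mn); elim: (n - m)%N => [|k IH]; first by rewrite addn0 d0.
rewrite addnS; have /andP[a _] := w1 (m + k)%N.
exact: leq_trans (dist_adj _ a) _.
Qed.

HB.instance Definition _ q (X : htree q) :=
  isPointed.Build (ray X) (projT1 (cid (ray_exists X))).

Definition through q (X : htree q) (x : tvertex X) : set (ray X) :=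
  [set w | exists n, w n = x].

(* Omega, with the sigma-algebra generated by the sets E(x) = [through x]. *)
Notation boundary X := (g_sigma_algebraType (range (@through _ X))).

Definition height (R : realType) q (X : htree q) (w : ray X) (x : tvertex X) : R :=
  lim ((m%:R - (dist x (w m))%:R : R) @[m --> \oo]).

Definition boundary_measure (R : realType) q (X : htree q)
    (nu : probability (boundary X) R) : Prop :=
  forall x : tvertex X, x <> root X ->
    nu (through x) = (q%:R / (q.+1%:R * q%:R ^+ dist (root X) x))%:E.

Local Notation Re := complex.Re.
Local Notation Im := complex.Im.

Section complex_valued.
Context {R : realType}.

Definition cexp (z : R[i]) : R[i] :=
  (expR (Re z) * cos (Im z)) +i* (expR (Re z) * sin (Im z)).

(* a ^ z = exp (z ln a), for a > 0 *)
Definition cpow (a : R) (z : R[i]) : R[i] := cexp (z * (ln a)%:C).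

Definition cmeasurable_fun d (T : measurableType d) (D : set T)
    (F : T -> R[i]) : Prop :=
  measurable_fun D (fun t => Re (F t)) /\ measurable_fun D (fun t => Im (F t)).

Definition cintegrable d (T : measurableType d)
    (m : {measure set T -> \bar R}) (D : set T) (F : T -> R[i]) : Prop :=
  cmeasurable_fun D F /\ (\int[m]_(t in D) (normc (F t))%:E < +oo)%E.

Definition cintegral d (T : measurableType d)
    (m : {measure set T -> \bar R}) (D : set T) (F : T -> R[i]) : R[i] :=
  (\int[m]_(t in D) Re (F t)) +i* (\int[m]_(t in D) Im (F t)).

End complex_valued.

Section plancherel.
Context (R : realType) (q : nat).
Local Notation Q := (q%:R : R).

Definition tau : R := pi / ln Q.

(* The c-function.  For real z in [0, tau] its denominator vanishes only at
   the endpoints; there cfun z = 0 and plancherel_density z = 0 by the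
   convention 0^-1 = 0. *)
Definition cfun (z : R[i]) : R[i] :=
  (Num.sqrt Q / (Q + 1))%:C *
  ((cpow Q ((2^-1)%:C + 'i * z) - cpow Q (- (2^-1)%:C - 'i * z)) /
   (cpow Q ('i * z) - cpow Q (- ('i * z)))).

Definition cP : R := Q * ln Q / (2 * pi * (Q + 1)).

Definition plancherel_density (s : R) : R := cP * (normc (cfun s%:C)) ^- 2.

(* The measure c_P |c(s)|^-2 ds on [0, tau], as a measure on R. *)
Definition plancherel (A : set R) : \bar R :=
  (\int[lebesgue_measure]_(s in A `&` `[0%R, tau]%classic)
     (plancherel_density s)%:E)%E.

Lemma cpowE (a b : R) : cpow Q (a +i* b) =
  (expR (a * ln Q) * cos (b * ln Q)) +i* (expR (a * ln Q) * sin (b * ln Q)).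
Proof. by rewrite /cpow /cexp /=; simpc. Qed.

Lemma normc_cpow (a b : R) : normc (cpow Q (a +i* b)) = expR (a * ln Q).
Proof.
by rewrite cpowE /= !exprMn -mulrDr cos2Dsin2 mulr1 sqrtr_sqr ger0_norm ?expR_ge0.
Qed.

Lemma normc_cfun (s : R) : normc (cfun s%:C) = (Num.sqrt Q / (Q + 1)) *
  (normc (cpow Q (2^-1 +i* s) - cpow Q (- 2^-1 +i* - s)) /
   normc (cpow Q (0 +i* s) - cpow Q (0 +i* - s))).
Proof.
rewrite /cfun !normcM normcV; congr (_ * (normc _ / normc _)).
- by rewrite /= expr0n /= addr0 sqrtr_sqr ger0_norm// divr_ge0// ?sqrtr_ge0.
- by congr (cpow _ _ - cpow _ _); simpc.
- by congr (cpow _ _ - cpow _ _); simpc.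
Qed.

Lemma cP_ge0 : 0 <= cP.
Proof.
have l0 : 0 <= ln Q.
  by case: (q) => [|n]; [rewrite ln0|rewrite ln_ge0// ler1n].
by apply: divr_ge0; apply: mulr_ge0 => //; rewrite mulr_ge0 ?pi_ge0.
Qed.

Lemma plancherel_density_ge0 s : 0 <= plancherel_density s.
Proof. by rewrite mulr_ge0 ?cP_ge0// invr_ge0 sqr_ge0. Qed.

Let cnum s := cpow Q (2^-1 +i* s) - cpow Q (- 2^-1 +i* - s).
Let cden s := cpow Q (0 +i* s) - cpow Q (0 +i* - s).

Let normc_sqr (z : R[i]) : normc z ^+ 2 = Re z ^+ 2 + Im z ^+ 2.
Proof. by case: z => a b /=; rewrite sqr_sqrtr// addr_ge0 ?sqr_ge0. Qed.

Let plancherel_densityE s : plancherel_density s =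
  cP * (Num.sqrt Q / (Q + 1)) ^- 2 * normc (cden s) ^+ 2 *
  (normc (cnum s) ^+ 2) `^ (- 1).
Proof.
rewrite powR_inv1 ?sqr_ge0// /plancherel_density normc_cfun -/(cnum s) -/(cden s).
move: (normc (cnum s)) (normc (cden s)) (Num.sqrt Q / (Q + 1)) => n d K.
have -> : (K * (n / d)) ^- 2 = K ^- 2 * (d ^+ 2 / n ^+ 2).
  by rewrite -!exprVn !invfM invrK !exprMn [n^-1 ^+ 2 * _]mulrC.
by rewrite !mulrA.
Qed.

Let measurable_normc_line (a b : R) : measurable_fun [set: R]
  (fun s => normc (cpow Q (a +i* s) - cpow Q (b +i* - s)) ^+ 2).
Proof.
have mc (f : R -> R) : continuous f -> measurable_fun [set: R] (fun s => f (s * ln Q)).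
  move=> /continuous_measurable_fun mf; apply: (measurableT_comp mf).
  exact: measurable_funM.
under eq_fun do rewrite normc_sqr !cpowE /= mulNr cosN sinN mulrN opprK.
apply: measurable_funD; apply: measurable_funX.
- by apply: measurable_funB; apply: measurable_funM => //; apply: mc; exact: continuous_cos.
- by apply: measurable_funD; apply: measurable_funM => //; apply: mc; exact: continuous_sin.
Qed.

Lemma measurable_plancherel_density :
  measurable_fun [set: R] plancherel_density.
Proof.
rewrite (funext plancherel_densityE); apply: measurable_funM.
  by apply: measurable_funM => //; exact: measurable_normc_line.
exact: (measurableT_comp (measurable_powR (- 1)) (measurable_normc_line _ _)).
Qed.

Lemma plancherel_density_bounded : exists M, forall s, plancherel_density s <= M.
Proof.
have [q1|q1] := leqP q 1%N.
  have l0 : ln Q = 0 by move: q1; case: (q) => [|[|//]] _; [rewrite ln0|rewrite ln1].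
  by exists 0 => s; rewrite /plancherel_density /cP l0 mulr0 mul0r mul0r.
have l0 : 0 < ln Q by rewrite ln_gt0// ltr1n.
pose D := expR (2^-1 * ln Q) - expR (- 2^-1 * ln Q).
have D0 : 0 < D.
  by rewrite subr_gt0 ltr_expR ltr_pM2r// gtrN// invr_gt0.
have nB (z w : R[i]) : normc (z - w) <= normc z + normc w.
  by rewrite -[normc w]normcN le_normcD.
have num_ge s : D <= normc (cnum s).
  rewrite /D -(normc_cpow _ s) -(normc_cpow _ (- s)) lerBlDr.
  by rewrite -{1}[cpow _ (2^-1 +i* s)](subrK (cpow Q (- 2^-1 +i* - s))) le_normcD.
have den_le s : normc (cden s) <= 2.
  by rewrite (le_trans (nB _ _))// !normc_cpow mul0r expR0.
exists (cP * (Num.sqrt Q / (Q + 1)) ^- 2 * 2 ^+ 2 * (D ^+ 2)^-1) => s.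
have n0 (z : R[i]) : 0 <= normc z by case: z => *; rewrite /= sqrtr_ge0.
rewrite plancherel_densityE powR_inv1 ?sqr_ge0//.
have c0 : 0 <= cP * (Num.sqrt Q / (Q + 1)) ^- 2.
  by rewrite mulr_ge0 ?cP_ge0// invr_ge0 sqr_ge0.
apply: ler_pM.
- exact: mulr_ge0 c0 (sqr_ge0 _).
- by rewrite invr_ge0 sqr_ge0.
- by apply: ler_wpM2l => //; rewrite lerXn2r ?nnegrE.
- rewrite lef_pV2 ?posrE ?exprn_gt0// ?(lt_le_trans D0)//.
  by rewrite lerXn2r ?nnegrE// ltW.
Qed.

Let plancherel0 : plancherel set0 = 0%E.
Proof. by rewrite /plancherel set0I integral_set0. Qed.

Let plancherel_ge0 A : (0 <= plancherel A)%E.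
Proof.
by apply: integral_ge0 => s _; rewrite lee_fin plancherel_density_ge0.
Qed.

Let measurable_EFin_density (A : set R) :
  measurable_fun A (EFin \o plancherel_density).
Proof.
by apply/measurable_EFinP/measurable_funTS; exact: measurable_plancherel_density.
Qed.

Let plancherel_sigma_additive : semi_sigma_additive plancherel.
Proof.
move=> A mA tA mUA; rewrite /plancherel setI_bigcupl ge0_integral_bigcup//=.
- by apply: is_cvg_ereal_nneg_natsum_cond => n _ _; exact: plancherel_ge0.
- by move=> k; apply: (measurableI _ _ (mA k) (measurable_itv _)).
- exact: (@measurable_EFin_density _).
- by move=> s _; rewrite lee_fin plancherel_density_ge0.
- exact: trivIset_setIr.
Qed.

HB.instance Definition _ := isMeasure.Build _ _ _ plancherel
  plancherel0 plancherel_ge0 plancherel_sigma_additive.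

Let plancherel_finite : fin_num_fun plancherel.
Proof.
move=> A mA; rewrite ge0_fin_numE ?plancherel_ge0//.
have [M densM] := plancherel_density_bounded.
have mI : measurable (A `&` `[0, tau]%classic) by apply: measurableI => //; exact: measurable_itv.
apply: (@le_lt_trans _ _
    (\int[lebesgue_measure]_(s in A `&` `[0%R, tau]%classic) M%:E)%E).
  apply: ge0_le_integral => //.
  - by move=> s _; rewrite lee_fin plancherel_density_ge0.
  - exact: (@measurable_EFin_density _).
  - by move=> s _; rewrite lee_fin.
rewrite integral_cst//.
have M0 : 0 <= M := le_trans (plancherel_density_ge0 0) (densM 0).
rewrite lte_mul_pinfty// (@le_lt_trans _ _ (lebesgue_measure `[0, tau]%classic))//.
  apply: le_measure; last exact: subIsetr.
  - by apply/mem_set; exact: mI.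
  - by apply/mem_set; exact: measurable_itv.
by rewrite /= lebesgue_measure_itv /=; case: ifPn => _; rewrite -?EFinD ltry.
Qed.

HB.instance Definition _ := Measure_isFinite.Build _ _ _ plancherel
  plancherel_finite.

End plancherel.

Section operators.
Context {R : realType} {q : nat} {X : htree q}.
Implicit Types (f g : tvertex X -> R[i])
  (T : (tvertex X -> R[i]) -> tvertex X -> R[i]).

Definition finitely_supported f : Prop := finite_set [set x | f x != 0].

Definition L2norm f : \bar R :=
  Lnorm (@counting (tvertex X) R) 2%:E (fun x => (normc (f x))%:E).

Definition inL2 f : Prop := (L2norm f < +oo)%E.

(* Only the values of [T] on L^2 matter. *)
Definition bounded_linear_L2 T : Prop :=
  [/\ forall f, inL2 f -> inL2 (T f),
      forall (a : R[i]) f g, inL2 f -> inL2 g ->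
        T (fun x => a * f x + g x) = (fun x => a * T f x + T g x)
    & exists M : R, forall f, inL2 f -> (L2norm (T f) <= M%:E * L2norm f)%E].

Definition opnormL2 T : \bar R :=
  ereal_sup [set L2norm (T f) | f in [set f | (L2norm f <= 1)%E]].

(* The big sum over a set is the sum over the support of the summand when
   that support is finite. *)
Definition helgason f (w : ray X) (s : R) : R[i] :=
  \sum_(y \in [set: tvertex X])
    f y * cpow q%:R (((2^-1)%:C + 'i * s%:C) * (height R w y)%:C).

Definition pdo_integrand (sigma : tvertex X * boundary X * R -> R[i]) f
    (x : tvertex X) (z : boundary X * R) : R[i] :=
  cpow q%:R (((2^-1)%:C - 'i * z.2%:C) * (height R z.1 x)%:C) *
  sigma (x, z.1, z.2) * helgason f z.1 z.2.

(* Omega x [0, tau] *)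
Definition phase_space : set (boundary X * R) :=
  [set: boundary X] `*` `[0, tau R q]%classic.

Definition pdo (nu : probability (boundary X) R)
    (sigma : tvertex X * boundary X * R -> R[i]) f (x : tvertex X) : R[i] :=
  cintegral (nu \x @plancherel R q)%E phase_space (pdo_integrand sigma f x).

Definition measurable_symbol (sigma : tvertex X * boundary X * R -> R[i]) : Prop :=
  cmeasurable_fun ([set: tvertex X * boundary X] `*` `[0, tau R q]%classic) sigma.

End operators.

(* Main.v *)
(* For finitely supported f the integral defining T_sigma f(x) is at most
   C |v(x)| times the L^1 norm of the Fourier-Helgason transform Hf, so all rests
   on the Plancherel inequality ||Hf||_2 <= B ||f||_2 over a finite measure space.

   Since |c(s)|^-2 is at most a constant times sin^2(s log q), the s-integral of
   |Hf|^2 is controlled by the quadratic form in f with kernel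
     K(y, z) = int q^((h(y) + h(z))/2) kappa(h(y) - h(z)) dnu,
   where kappa collects the Fourier coefficients of 4 sin^2: it is 2 at 0, -1 at
   2 and -2, and 0 elsewhere.  Along the geodesic from y to z the height rises j
   times and then falls, and the set of rays rising along a given edge (x, x')
   has q^h(x) nu-mass 1/(q + 1), whatever the edge.  Hence for d(y, z) > 2 the
   kernel is a telescoping sum of second differences and vanishes: K has finite
   range, and Schur's test bounds it on l^2.

   Thus |T_sigma f(x)| <= B' C |v(x)| ||f||_2, i.e. the row at x of the matrix of
   T_sigma has l^2 norm at most B' C |v(x)|, and this matrix defines the extension. *)
Require Import Defs.
From mathcomp Require Import all_boot all_order all_algebra.
From mathcomp Require Import all_classical all_reals all_analysis.
From mathcomp Require Import complex.
From mathcomp Require Import measurable_realfun finmap ring lra zify.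
Set Implicit Arguments.
Unset Strict Implicit.
Unset Printing Implicit Defensive.
Import Order.TTheory GRing.Theory Num.Theory.
Import numFieldNormedType.Exports.
Import Normc.
Local Open Scope classical_set_scope.
Local Open Scope ring_scope.
Local Open Scope complex_scope.

(** * Heights of rays in the tree *)

Section tree_distance.
Context {q : nat} {X : htree q}.
Implicit Types (x y z : tvertex X) (w : ray X).

Lemma distxx x : dist x x = 0%N.
Proof. by apply/eqP; rewrite -leqn0; exact: (@dist_le _ _ x [::]). Qed.

Lemma dist_eq0 x y : dist x y = 0%N -> x = y.
Proof. by have [p _ [-> <-]] := dist_walk x y => /size0nil ->. Qed.

Lemma dist_sym x y : dist x y = dist y x.
Proof.
suff le (a b : tvertex X) : (dist a b <= dist b a)%N by apply/eqP; rewrite eqn_leq !le.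
have [p bp [-> <-]] := dist_walk b a.
have := @dist_le q X (last b p) (rev (belast b p)).
have rp : path adj (last b p) (rev (belast b p)).
  by rewrite rev_path; apply: sub_path bp => u v; rewrite /= adj_sym.
have -> : last (last b p) (rev (belast b p)) = b.
  by case: (p) => [//|c r]; rewrite /= rev_cons last_rcons.
by rewrite size_rev size_belast; exact.
Qed.

Lemma dist_closer o x : x <> o ->
  exists2 y, adj x y & (dist o y).+1 = dist o x.
Proof.
have [p] := dist_walk o x; case/lastP: p => [_ [->]//|p z].
rewrite rcons_path last_rcons size_rcons => /andP[op pz] [-> pn] _.
exists (last o p); first by rewrite adj_sym.
by apply/eqP; rewrite eqn_leq (dist_adj _ pz) -pn ltnS dist_le.
Qed.

(** Equal distances are impossible: the neighbour of [x] closer to [o] would then be a second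
    neighbour of [x] not farther than [x], against [nbr_unique]. *)
Lemma adj_dist o x y : adj x y ->
  dist o y = (dist o x).+1 \/ dist o x = (dist o y).+1.
Proof.
move=> xy; have yx : adj y x by rewrite adj_sym.
have := dist_adj o xy; rewrite leq_eqVlt => /orP[/eqP|]; first by left.
rewrite ltnS => yx_le.
have := dist_adj o yx; rewrite leq_eqVlt => /orP[/eqP|]; first by right.
rewrite ltnS => xy_le; have dxy : dist o x = dist o y by lia.
have [xo|/dist_closer[z xz dz]] := pselect (x = o).
  move: dxy; rewrite xo distxx => /esym/dist_eq0 oy.
  by move: xy; rewrite xo oy adj_irr.
have := nbr_unique xy xz yx_le; rewrite -dz leqnSn => /(_ isT) yz.
by rewrite yz in dxy; lia.
Qed.

Lemma ray_dist w n : dist (Defs.root X) (w n) = n.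
Proof. by rewrite -(ray_root w) ray_geodesic// subn0. Qed.

Lemma dist1_adj x y : dist x y = 1%N -> adj x y.
Proof.
move=> d1; have [p xp [yE ]] := dist_walk x y; rewrite d1 yE.
by case: p xp {yE} => [|a [|b p]] //= /andP[].
Qed.

Lemma ray_adj w n : adj (w n) (w n.+1).
Proof. by apply: dist1_adj; rewrite ray_geodesic// subSnn. Qed.

(** The second alternative says that the ray still follows the geodesic from the root to [x]. Once
    it has moved away it never returns: a return step would make [w m] and [w m.+2] two neighbours
    of [w m.+1] closer to [x], hence equal. *)
Lemma ray_turn w x m : dist x (w m.+1) = (dist x (w m)).+1 \/
  (dist x (w m.+1) + m.+1)%N = dist (Defs.root X) x.
Proof.
elim: m => [|m IHm].
  by case: (adj_dist x (ray_adj w 0)); rewrite ray_root (dist_sym x (Defs.root X)); lia.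
case: (adj_dist x (ray_adj w m.+1)) => dm; first by left.
right; case: IHm => [dm'|]; last by lia.
have a : adj (w m.+1) (w m) by rewrite adj_sym ray_adj.
have e : w m = w m.+2.
  by apply: (nbr_unique (o := x) a (ray_adj w m.+1)); lia.
have := ray_dist w m.
by rewrite e ray_dist; lia.
Qed.

Lemma ray_away w x m : (dist (Defs.root X) x <= m)%N ->
  dist x (w m.+1) = (dist x (w m)).+1.
Proof. by case: (ray_turn w x m) => //; lia. Qed.

(** An integer form of the height: at time [|x|] the sequence [m - d(x, w_m)] has become stationary,
    so its limit is read off there. *)
Definition iheight w x : int :=
  (dist (Defs.root X) x)%:Z - (dist x (w (dist (Defs.root X) x)))%:Z.

Lemma iheightE w x m : (dist (Defs.root X) x <= m)%N ->
  iheight w x = m%:Z - (dist x (w m))%:Z.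
Proof.
move=> xm; rewrite -(subnKC xm); elim: (m - _)%N => [|k IHk].
  by rewrite addn0.
by rewrite IHk addnS ray_away ?leq_addr//; lia.
Qed.

Lemma iheight_root w : iheight w (Defs.root X) = 0.
Proof. by rewrite /iheight distxx ray_root distxx. Qed.

Lemma iheight_adj w x y : adj x y ->
  iheight w y = iheight w x + 1 \/ iheight w y = iheight w x - 1.
Proof.
move=> xy; set m := maxn (dist (Defs.root X) x) (dist (Defs.root X) y).
rewrite (@iheightE w x m) ?leq_maxl// (@iheightE w y m) ?leq_maxr//.
by have := adj_dist (w m) xy; rewrite !(dist_sym (w m)); lia.
Qed.

(** For large [m] the height is [m] minus the distance to [w m], so a rise is a step toward [w m],
    and [nbr_unique] based at [w m] applies. *)
Lemma iheight_up_unique w x y z : adj x y -> adj x z ->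
  iheight w y = iheight w x + 1 -> iheight w z = iheight w x + 1 -> y = z.
Proof.
move=> xy xz; set d := dist (Defs.root X).
set m := (d x + d y + d z)%N.
rewrite (@iheightE w x m) ?(@iheightE w y m) ?(@iheightE w z m) -/d; try lia.
by move=> hy hz; apply: (@nbr_unique _ _ (w m) x) => //; rewrite !(dist_sym (w m)); lia.
Qed.

(** If the first step fell, both [x] and [z] would be upper neighbours of [y]. Hence along a walk
    without backtracking the height first rises and then falls. *)
Lemma iheight_nested w x y z : adj x y -> adj y z -> x <> z ->
  iheight w z = iheight w y + 1 -> iheight w y = iheight w x + 1.
Proof.
move=> xy yz xz hz; case: (iheight_adj w xy) => // hy; case: xz.
by apply: (@iheight_up_unique w y) => //; [rewrite adj_sym | rewrite hy subrK].
Qed.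

Lemma throughE w x : through x w <-> w (dist (Defs.root X) x) = x.
Proof.
split=> [[n <-]|wx]; first by rewrite ray_dist.
by exists (dist (Defs.root X) x).
Qed.

Lemma iheight_through w x : through x w -> iheight w x = (dist (Defs.root X) x)%:Z.
Proof. by move=> /throughE e; rewrite /iheight e distxx subr0. Qed.

Lemma through_parent w x y : adj x y ->
    dist (Defs.root X) y = (dist (Defs.root X) x).+1 ->
  through y w -> through x w.
Proof.
move=> xy dy /throughE; rewrite dy => wy; apply/throughE.
apply: (@nbr_unique _ _ (Defs.root X) y).
- by rewrite adj_sym -wy ray_adj.
- by rewrite adj_sym.
- by rewrite ray_dist dy leqnSn.
- by rewrite dy leqnSn.
Qed.

(** Turns the boundary set [E(y)] into a condition on heights. The converse goes by induction on
    depth: a rise into [y] forces, by nesting, a rise into [x], so the ray passes through [x] and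
    continues to its unique upper neighbour [y]. *)
Lemma through_iheight w x y : adj x y ->
    dist (Defs.root X) y = (dist (Defs.root X) x).+1 ->
  through y w <-> iheight w y = iheight w x + 1.
Proof.
move=> xy dy; split=> [wy|].
  rewrite (iheight_through wy) (iheight_through (through_parent xy dy wy)) dy; lia.
move dxE: (dist (Defs.root X) x) => n; elim: n x y xy dy dxE => [|n IHn] x y xy dy dx hy.
  have xE := dist_eq0 dx; rewrite -xE in xy hy *; exists 1%N.
  apply: (@iheight_up_unique w (Defs.root X)) => //.
    by rewrite -{1}(ray_root w) ray_adj.
  by rewrite iheight_root add0r (@iheightE _ _ 1) ?distxx// ray_dist.
have [z xz dz] : exists2 y, adj x y & (dist (Defs.root X) y).+1 = dist (Defs.root X) x.
  by apply: dist_closer => xo; rewrite xo distxx in dx.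
have wx : through x w.
  apply: (IHn z x) => //; first by rewrite adj_sym.
    by lia.
  apply: (iheight_nested _ xy _ hy); first by rewrite adj_sym.
  by move=> zy; rewrite zy dy in dz; lia.
apply/throughE; apply: (@iheight_up_unique w x) => //.
  by move/throughE: wx => {1}<-; rewrite dy ray_adj.
rewrite (iheight_through wx) dy (@iheightE _ _ (dist (Defs.root X) x).+1) ?ray_dist//.
by rewrite distxx; lia.
Qed.

Lemma heightE (R : realType) w x : height R w x = (iheight w x)%:~R.
Proof.
apply/cvg_lim => //; apply: cvg_near_cst; exists (dist (Defs.root X) x) => // m /= xm.
by rewrite (iheightE w xm) intrB.
Qed.

Fixpoint reduced_walk x (s : seq (tvertex X)) : Prop :=
  if s is y :: s' then
    [/\ adj x y, (if s' is z :: _ then x <> z else True) & reduced_walk y s']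
  else True.

Lemma geodesic_reduced x (s : seq (tvertex X)) : path adj x s ->
  dist x (last x s) = size s -> reduced_walk x s.
Proof.
elim: s x => [//|y s IHs] x /= /andP[xy ys] /= ds.
have := dist_triangle x y (last y s); rewrite ds.
have xy1 : (dist x y <= 1)%N by apply: (@dist_le _ _ x [:: y]); rewrite /= xy.
have dle : (dist y (last y s) <= size s)%N := dist_le ys.
move=> tri; split=> //; last by apply: IHs => //; lia.
case: s ys {IHs} ds tri dle => [//|z s] /= /andP[yz zs] ds tri dle xz.
have : (dist z (last z s) <= size s)%N := dist_le zs.
by rewrite -xz in ds * => zl; lia.
Qed.

End tree_distance.

(** * Masses of boundary sets *)

Section integral_value.
Context d (T : measurableType d) (R : realType).
Variables (m : {measure set T -> \bar R}) (D : set T).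
Hypothesis mD : measurable D.
Implicit Types (f g : T -> R) (a b c : R).

(** Integrability and value travel together, so that linearity rules compose without separate
    integrability goals. *)
Definition has_integral f c :=
  m.-integrable D (EFin \o f) /\ \int[m]_(t in D) f t = c.

Lemma has_integralD f g a b : has_integral f a -> has_integral g b ->
  has_integral (fun t => f t + g t) (a + b).
Proof.
move=> [fi <-] [gi <-]; split; last by rewrite RintegralD.
exact: (integrableD mD fi gi).
Qed.

Lemma has_integralZ c f a : has_integral f a ->
  has_integral (fun t => c * f t) (c * a).
Proof.
move=> [fi <-]; split; last by rewrite RintegralZl.
exact: (integrableZl mD c fi).
Qed.

Lemma has_integral_cond f c : has_integral f c -> forall c', c = c' -> has_integral f c'.
Proof. by move=> ? ? <-. Qed.

Lemma has_integral_sum (I : Type) (s : seq I) (F : I -> T -> R) (c : I -> R) :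
  (forall i, has_integral (F i) (c i)) ->
  has_integral (fun t => \sum_(i <- s) F i t) (\sum_(i <- s) c i).
Proof.
move=> Fc; elim: s => [|i s IHs].
  rewrite big_nil; under [X in has_integral X]eq_fun do rewrite big_nil.
  split; first exact: integrable0.
  by rewrite /Rintegral integral0.
rewrite big_cons; under [X in has_integral X]eq_fun do rewrite big_cons.
exact: has_integralD.
Qed.

Lemma has_integral_EFin f c : has_integral f c ->
  (\int[m]_(t in D) (f t)%:E)%E = c%:E.
Proof. by move=> [fi <-]; rewrite /Rintegral fineK// integrable_fin_num. Qed.

End integral_value.

Section boundary.
Context {R : realType} {q : nat} {X : htree q}.
Implicit Types (x y z : tvertex X) (w : ray X) (g : int -> R).
Local Notation Q := (q%:R : R).

Lemma q_gt0 : 0 < Q.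
Proof. by rewrite ltr0n; have := htree_ge2 X; lia. Qed.

(* hpow k = q^(k/2) *)
Definition hpow (k : int) : R := expR (k%:~R * (ln Q / 2)).

Lemma hpowD k l : hpow (k + l) = hpow k * hpow l.
Proof. by rewrite /hpow intrD mulrDl expRD. Qed.

Lemma hpow0 : hpow 0 = 1.
Proof. by rewrite /hpow mul0r expR0. Qed.

Lemma hpow_gt0 k : 0 < hpow k.
Proof. exact: expR_gt0. Qed.

Lemma hpow2 : hpow 2 = Q.
Proof. by rewrite /hpow mulrCA divff// mulr1 lnK// posrE q_gt0. Qed.

Lemma hpow_nat n : hpow (2 * n%:Z) = Q ^+ n.
Proof.
elim: n => [|n IHn]; first by rewrite hpow0.
by rewrite exprS -IHn -hpow2 -hpowD; congr hpow; lia.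
Qed.

Lemma measurable_through x : measurable (@through q X x : set (boundary X)).
Proof. by apply: sub_gen_smallest; exists x. Qed.

(** Expresses the change of height along an outward edge by the indicator of [E(y)]; measurability
    of the height follows by induction outward from the root. *)
Lemma iheight_child w x y : adj x y ->
    dist (Defs.root X) y = (dist (Defs.root X) x).+1 ->
  (iheight w y)%:~R = (iheight w x)%:~R + (2 * \1_(through y) w - 1) :> R.
Proof.
move=> xy dy; rewrite indicE; have [up1 up2] := through_iheight w xy dy.
have [wy|wy] := pselect (through y w); rewrite ?(mem_set wy) ?(memNset wy).
  by rewrite (up1 wy) intrD mulr1; ring.
by case: (iheight_adj w xy) => [/up2//|->]; rewrite intrB mulr0 sub0r.
Qed.

Lemma vertex_ind (P : tvertex X -> Prop) : P (Defs.root X) ->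
  (forall x y, adj x y -> dist (Defs.root X) y = (dist (Defs.root X) x).+1 ->
    P x -> P y) -> forall x, P x.
Proof.
move=> P0 PS x; move dE: (dist (Defs.root X) x) => n.
elim: n x dE => [x /dist_eq0 <-//|n IHn x dx].
have [y xy dy] : exists2 y, adj x y & (dist (Defs.root X) y).+1 = dist (Defs.root X) x.
  by apply: dist_closer => xo; rewrite xo distxx in dx.
apply: (PS y) => //; first by rewrite adj_sym.
by apply: IHn; lia.
Qed.

Lemma measurable_iheight x :
  measurable_fun [set: boundary X] (fun w : boundary X => (iheight w x)%:~R : R).
Proof.
elim/vertex_ind: x => [|x y xy dy mx].
  by rewrite (_ : (fun _ => _) = cst 0)//; apply/funext => w; rewrite iheight_root.
rewrite (funext (fun w => iheight_child w xy dy)).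
apply: measurable_funD => //; apply: measurable_funB => //.
apply: measurable_funM => //; apply: measurable_indic.
exact: measurable_through.
Qed.

Definition up_indic x y w : R := (iheight w y == iheight w x + 1)%:R.

(** The factor 2 undoes the half power in [hpow]: the weight is [q^h(x)], the Poisson kernel at
    [x]. *)
Definition up_mass x y w : R := hpow (2 * iheight w x) * up_indic x y w.

Variables (nu : probability (boundary X) R).
Hypothesis hnu : boundary_measure nu.

Let is_int := @has_integral _ (boundary X) R nu setT.

Lemma has_integral_through x y : adj x y ->
    dist (Defs.root X) y = (dist (Defs.root X) x).+1 ->
  is_int (\1_(through y)) (Q / (Q + 1) / Q ^+ (dist (Defs.root X) y)).
Proof.
move=> xy dy; split; first by apply: integrable_indic; exact: measurable_through.
rewrite /Rintegral integral_indic ?setIT//; last exact: measurable_through.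
apply: etrans (congr1 fine (hnu _)) _.
  by move=> yo; rewrite yo distxx in dy.
by rewrite /= -addn1 natrD invfM mulrA.
Qed.

(** The Poisson kernel has total mass one. From [x] to a child [y] it is divided by [q] off [E(y)]
    and becomes [q^|y|] on [E(y)]; the measure of [E(y)] balances the two changes. *)
Lemma has_integral_hpow x : is_int (fun w => hpow (2 * iheight w x)) 1.
Proof.
have q0 := q_gt0.
elim/vertex_ind: x => [|x y xy dy IHx].
  under [X in is_int X]eq_fun do rewrite iheight_root mulr0 hpow0.
  split; first exact: finite_measure_integrable_cst.
  by rewrite Rintegral_cst//= probability_setT mul1r.
have e w : hpow (2 * iheight w y) = Q^-1 * hpow (2 * iheight w x) +
  (Q ^+ dist (Defs.root X) y - Q^-1 * Q ^+ dist (Defs.root X) x) * \1_(through y) w.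
  rewrite indicE; have [wy|wy] := pselect (through y w); rewrite ?(mem_set wy) ?(memNset wy).
    rewrite (iheight_through wy) (iheight_through (through_parent xy dy wy)).
    by rewrite !hpow_nat mulr1; ring.
  have /= -> : iheight w y = iheight w x - 1.
    by case: (iheight_adj w xy) => // /(through_iheight w xy dy).
  rewrite mulr0 addr0 mulrBr hpowD mulrC; congr (_ * _).
  by rewrite -hpow2 -[RHS]mul1r -hpow0 -(subrr 2) hpowD mulrAC mulfV ?mul1r// gt_eqF// hpow_gt0.
under [X in is_int X]eq_fun do rewrite e.
apply: has_integral_cond.
  apply: has_integralD => //; apply: has_integralZ => //; first exact: IHx.
  exact: has_integral_through xy dy.
rewrite dy exprS; have : Q ^+ dist (Defs.root X) x != 0 by rewrite expf_neq0// gt_eqF.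
move: (Q ^+ _) => p p0; field.
by rewrite p0 !gt_eqF// addr_gt0.
Qed.

(** Along an outward edge the rising rays form [E(y)], where the weight is [q^|x|]. Along an inward
    edge they form the complement of [E(x)], whose mass is one minus [q^|x| nu(E(x))]. Both give the
    same value. *)
Lemma has_integral_up x y : adj x y -> is_int (up_mass x y) (Q + 1)^-1.
Proof.
have q0 := q_gt0; have nz n : Q ^+ n != 0 by rewrite expf_neq0// gt_eqF.
move=> xy; case: (adj_dist (Defs.root X) xy) => [dy|dx].
  rewrite (_ : up_mass x y = fun w => Q ^+ dist (Defs.root X) x * \1_(through y) w); last first.
    apply/funext => w; rewrite /up_mass /up_indic indicE.
    have [wy|wy] := pselect (through y w); rewrite ?(mem_set wy) ?(memNset wy).
      move/(through_iheight w xy dy): (wy) => ->; rewrite eqxx.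
      by rewrite (iheight_through (through_parent xy dy wy)) hpow_nat.
    by case: eqP => [/(through_iheight w xy dy)//|_]; rewrite !mulr0.
  apply: has_integral_cond.
    by apply: has_integralZ => //; exact: has_integral_through xy dy.
  rewrite dy exprS; move: (nz (dist (Defs.root X) x)); move: (Q ^+ _) => p p0; field.
  by rewrite p0 !gt_eqF// addr_gt0.
have yx : adj y x by rewrite adj_sym.
rewrite (_ : up_mass x y = fun w => hpow (2 * iheight w x) +
    (- Q ^+ dist (Defs.root X) x) * \1_(through x) w); last first.
  apply/funext => w; rewrite /up_mass /up_indic indicE.
  have [wx|wx] := pselect (through x w); rewrite ?(mem_set wx) ?(memNset wx).
    move/(through_iheight w yx dx): (wx) => e; case: eqP => [|_]; first by lia.
    by rewrite (iheight_through wx) hpow_nat mulr0 mulr1 subrr.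
  case: eqP => [_|]; first by rewrite mulr0 addr0 mulr1.
  by case: (iheight_adj w yx) => [/(through_iheight w yx dx)//|->]; lia.
apply: has_integral_cond.
  apply: has_integralD => //; first exact: has_integral_hpow.
  by apply: has_integralZ => //; exact: has_integral_through yx dx.
move: (nz (dist (Defs.root X) x)); move: (Q ^+ _) => p p0; field.
by rewrite p0 !gt_eqF// addr_gt0.
Qed.

End boundary.

(** * Kernels along a geodesic and their cancellation *)

Section walk_kernel.
Context {R : realType} {q : nat} {X : htree q}.
Implicit Types (x y z : tvertex X) (s : seq (tvertex X)) (w : ray X).
Implicit Types (g eta : int -> R).
Local Notation Q := (q%:R : R).
Local Notation hpow := (@hpow R q).
Local Notation up_mass := (@up_mass R q X).

(** If a walk of length [n] from [x] to [z] has [j] rises and then [n - j] falls, then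
    [(h(x) + h(z))/2 = h(x) + j - n/2] and [h(x) - h(z) = n - 2j]. Each term is the increment of
    [q^j g(n - 2j)] under one more rise, carried by the rays that rise that far. *)
Fixpoint walk_mass x s g w : R :=
  if s is y :: s' then
    (Q * g ((size s')%:Z - 1) - g ((size s')%:Z + 1)) * up_mass x y w +
    walk_mass y s' (fun k => g (k - 1)) w
  else 0.

(** The coefficients of [walk_mass] alone: every edge contributes the same integral, so only the
    length of the walk matters. *)
Fixpoint walk_total n g : R :=
  if n is n'.+1 then
    Q * g (n'%:Z - 1) - g (n'%:Z + 1) + walk_total n' (fun k => g (k - 1))
  else 0.

(** By nesting, no step rises after a fall, so all the indicators vanish. *)
Lemma walk_falling x y s g w : reduced_walk x (y :: s) ->
  iheight w y = iheight w x - 1 ->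
  walk_mass x (y :: s) g w = 0 /\
  iheight w (last y s) = iheight w x - (size s)%:Z - 1.
Proof.
elim: s x y g => [|z s IHs] x y g.
  move=> [xy _ _] hy; split; last by rewrite /= hy; lia.
  rewrite /= /up_mass /up_indic hy; case: eqP => [|_]; first by lia.
  by rewrite !mulr0 addr0.
move=> [xy xz yzs] hy; have [yz _ _] := yzs.
have hz : iheight w z = iheight w y - 1.
  case: (iheight_adj w yz) => // /(iheight_nested xy yz xz); lia.
have [m0 hl] := IHs y z (fun k => g (k - 1)) yzs hz.
split; last by rewrite /= hl hy /=; lia.
move: m0; rewrite /= => ->; rewrite addr0 /up_mass /up_indic hy.
by case: eqP => [|_]; [lia|rewrite !mulr0].
Qed.

(* Abel summation over the vertex where the ray leaves the walk. *)
Lemma walk_massE x s g w : reduced_walk x s ->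
  hpow (iheight w x + iheight w (last x s)) * g (iheight w x - iheight w (last x s)) =
  hpow (- (size s)%:Z) *
    (g (size s)%:Z * hpow (2 * iheight w x) + walk_mass x s g w).
Proof.
elim: s x g => [|y s IHs] x g.
  move=> _ /=; rewrite addr0 subrr oppr0 hpow0 mul1r mulrC.
  by congr (_ * hpow _); lia.
(* If the first step falls, the whole walk falls and only the boundary term of the summation
   survives. *)
move=> xs; have [xy _ ys] := xs; case: (iheight_adj w xy) => hy; last first.
  have [-> /= ->] := walk_falling g xs hy.
  rewrite addr0 [RHS]mulrCA [RHS]mulrC -hpowD; congr (hpow _ * g _); lia.
(* A first rise adds one to the height, which the shift of [g] by one compensates. *)
have := IHs y (fun k => g (k - 1)) ys.
rewrite /= (_ : iheight w y - _ - 1 = iheight w x - iheight w (last y s)); last lia.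
move=> e; have -> : hpow (iheight w x + iheight w (last y s)) =
    hpow (-1) * hpow (iheight w y + iheight w (last y s)).
  by rewrite -hpowD; congr hpow; lia.
rewrite -mulrA e mulrA -hpowD /up_mass /up_indic hy eqxx mulr1.
rewrite (_ : 2 * (iheight w x + 1) = 2 + 2 * iheight w x); last lia.
rewrite (hpowD 2) (hpow2 (X := X)) (_ : -1 - _ = - (size s).+1%:Z); last lia.
rewrite (_ : (size s)%:Z + 1 = (size s).+1%:Z); last lia.
by congr (_ * _); ring.
Qed.

Variables (nu : probability (boundary X) R).
Hypothesis hnu : boundary_measure nu.
Let is_int := @has_integral _ (boundary X) R nu setT.

Lemma has_integral_walk_mass x s g : reduced_walk x s ->
  is_int (walk_mass x s g) ((Q + 1)^-1 * walk_total (size s) g).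
Proof.
elim: s x g => [|y s IHs] x g /=.
  move=> _; rewrite mulr0; split; first exact: integrable0.
  by rewrite /Rintegral integral0.
move=> [xy _ ys]; apply: has_integral_cond.
  apply: has_integralD => //; last exact: IHs ys.
  by apply: has_integralZ => //; exact: has_integral_up xy.
by rewrite [RHS]mulrDr [_ * (_ - _)]mulrC.
Qed.

(** When [g] is a difference of step two, the coefficients [Q g(n - 2j - 2) - g(n - 2j)] telescope,
    and only values of [eta] near the ends [n] and [-n] remain. *)
Lemma walk_total_telescope n g eta : (forall k, g k = eta k - eta (k - 2)) ->
  walk_total n g = Q * (eta (n%:Z - 2) - eta (- n%:Z - 2)) -
                   (eta n%:Z - eta (- n%:Z)).
Proof.
elim: n g eta => [|n IHn] g eta ge /=; first by rewrite oppr0 !subrr mulr0 subr0.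
rewrite (IHn _ (fun k => eta (k - 1))) => [|k]; last first.
  by rewrite ge; congr (_ - eta _); lia.
rewrite !ge.
have -> : n%:Z - 1 - 2 = n%:Z - 2 - 1 by lia.
have -> : - n%:Z - 2 - 1 = - n.+1%:Z - 2 by lia.
have -> : - n%:Z - 1 = - n.+1%:Z by lia.
have -> : n.+1%:Z - 2 = n%:Z - 1 by lia.
have -> : n%:Z + 1 - 2 = n%:Z - 1 by lia.
have -> : n%:Z + 1 = n.+1%:Z by lia.
ring.
Qed.

(* The Fourier coefficients of 4 sin^2. *)
Definition kappa (k : int) : R :=
  2 * (k == 0)%:R - (k == 2)%:R - (k == - 2)%:R.

Definition pair_kernel y z w : R :=
  hpow (iheight w y + iheight w z) * kappa (iheight w y - iheight w z).

Lemma has_integral_pair_kernel y z : exists2 K : R,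
  is_int (pair_kernel y z) K & (2 < dist y z)%N -> K = 0.
Proof.
have [s ys [zE sE]] : exists2 s : seq (tvertex X), path adj y s &
  z = last y s /\ size s = dist y z := dist_walk y z.
have ry : reduced_walk y s by apply: geodesic_reduced => //; rewrite -zE sE.
rewrite (_ : pair_kernel y z = fun w => hpow (- (size s)%:Z) *
    (kappa (size s)%:Z * hpow (2 * iheight w y) + walk_mass y s kappa w)); last first.
  by apply/funext => w; rewrite /pair_kernel -(walk_massE _ _ ry) -zE.
eexists.
  apply: has_integralZ => //; apply: has_integralD => //.
    by apply: has_integralZ => //; exact: has_integral_hpow.
  exact: has_integral_walk_mass.
(* [kappa] is the step-two difference of this [eta], which is supported on 0 and -2. For length
   above 2 all the end values of [eta] are zero, and so is [kappa] at the length. *)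
rewrite -sE => s2; rewrite (@walk_total_telescope _ kappa (fun k => (k == 0)%:R - (k == -2)%:R)).
  rewrite /kappa; cbv beta; do !(case: eqP => [?|_]; first by exfalso; lia).
  by rewrite ?(mulr0n, mulr0, subr0, mul0r, addr0, oppr0).
move=> k; rewrite /kappa.
rewrite (_ : (k - 2 == 0) = (k == 2)); last lia.
rewrite (_ : (k - 2 == -2) = (k == 0)); last lia.
ring.
Qed.

End walk_kernel.

(** * Trigonometric integrals and the Plancherel density *)

Section trigonometric_integrals.
Context {R : realType}.
Implicit Types (a b c L : R) (k : int).
Local Notation leb := (@lebesgue_measure R).

Lemma sin_intpi k : sin (k%:~R * pi) = 0 :> R.
Proof.
have nat_case n : sin (n%:R * pi) = 0 :> R.
  elim: n => [|n IHn]; first by rewrite mul0r sin0.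
  by rewrite -addn1 natrD mulrDl mul1r sinDpi IHn oppr0.
case: k => n; first exact: nat_case.
by rewrite NegzE mulrNz mulNr sinN nat_case oppr0.
Qed.

Lemma is_derive_sinM a (x : R) : a != 0 ->
  is_derive x 1 (fun t => a^-1 * sin (a * t)) (cos (a * x)).
Proof.
move=> a0.
have da : is_derive x 1 (fun t => a * t) a.
  by have := is_deriveZ a (is_derive_id x (1 : R)); rewrite /GRing.scale/= mulr1.
have ds := is_derive_sin (a * x).
have := is_deriveZ a^-1 (is_derive1_comp (f := sin) ds da).
by rewrite /GRing.scale /= mulrCA mulVf ?mulr1.
Qed.

Lemma continuous_cosM a : continuous (fun t : R => cos (a * t)).
Proof.
move=> x; apply: (@continuous_comp _ _ _ (fun t => a * t) cos).
  exact: mulrl_continuous.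
exact: continuous_cos.
Qed.

(** For [k] nonzero the primitive is a multiple of [sin (k L s)], which vanishes at both ends of the
    interval. *)
Lemma has_integral_cos L k : 0 < L ->
  has_integral leb `[0, pi / L]%classic (fun s => cos (k%:~R * (L * s)))
    (pi / L * (k == 0)%:R).
Proof.
move=> L0; have piL : 0 < pi / L by rewrite divr_gt0 ?pi_gt0.
have cc : continuous (fun s : R => cos (k%:~R * (L * s))).
  by under eq_fun do rewrite mulrA; exact: continuous_cosM.
split.
  apply: continuous_compact_integrable; first exact: segment_compact.
  exact: continuous_subspaceT.
case: eqVneq => [->|k0].
  rewrite mulr1 (_ : (fun _ => _) = cst 1); last first.
    by apply/funext => s; rewrite mul0r cos0.
  rewrite Rintegral_cst// mul1r /= lebesgue_measure_itv/= lte_fin piL.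
  by rewrite -EFinD subr0.
have a0 : k%:~R * L != 0 by rewrite mulf_neq0 ?intr_eq0// gt_eqF.
set F := fun t => (k%:~R * L)^-1 * sin ((k%:~R * L) * t).
have cF : continuous F.
  by move=> x; apply: differentiable_continuous; apply/derivable1_diffP; case: (is_derive_sinM x a0).
rewrite /Rintegral (@continuous_FTC2 _ _ F)//=.
- rewrite /F mulr0 sin0 mulr0 (_ : _ * (pi / L) = k%:~R * pi); last first.
    by rewrite -mulrA [L * _]mulrC -mulrA mulVf ?mulr1// gt_eqF.
  by rewrite sin_intpi !mulr0 subr0.
- exact: continuous_subspaceT.
- split; [|exact/cvg_at_right_filter/cF|exact/cvg_at_left_filter/cF].
  by move=> x _; case: (is_derive_sinM x a0).
- by move=> x _; rewrite derive1E; have [_ ->] := is_derive_sinM x a0; rewrite mulrA.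
Qed.

(** The identity [cos(ku) sin(u)^2 = (2 cos(ku) - cos((k-2)u) - cos((k+2)u))/4] and orthogonality of
    the cosines produce [kappa]. *)
Lemma has_integral_cos_sin2 L k : 0 < L ->
  has_integral leb `[0, pi / L]%classic
    (fun s => cos (k%:~R * (L * s)) * sin (L * s) ^+ 2)
    (pi / L / 4 * kappa k).
Proof.
move=> L0; set I := `[0, pi / L]%classic.
have mI : measurable (I : set R) by exact: measurable_itv.
rewrite (_ : (fun _ => _) = fun s => 4^-1 * (2 * cos (k%:~R * (L * s)) +
  -1 * (cos ((k - 2)%:~R * (L * s)) + cos ((k + 2)%:~R * (L * s))))).
  apply: has_integral_cond.
    apply: has_integralZ => //; apply: has_integralD => //.
      by apply: has_integralZ => //; exact: has_integral_cos.
    by apply: has_integralZ => //; apply: has_integralD => //; exact: has_integral_cos.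
  rewrite /kappa (_ : (k - 2 == 0) = (k == 2)); last lia.
  rewrite (_ : (k + 2 == 0) = (k == - 2)); last lia.
  by field; rewrite gt_eqF.
apply/funext => s; set u := L * s.
rewrite (_ : (k - 2)%:~R * u = k%:~R * u - (u + u)); last by rewrite intrB; ring.
rewrite (_ : (k + 2)%:~R * u = k%:~R * u + (u + u)); last by rewrite intrD; ring.
rewrite !(cosD (k%:~R * u)) cosN sinN.
rewrite cosD sinD (_ : cos u * cos u - sin u * sin u = 1 - 2 * sin u ^+ 2).
  by field.
by have := cos2Dsin2 u; lra.
Qed.

End trigonometric_integrals.

(** * Comparing integrals when a measure is dominated by a density *)

Section density_domination.
Context d1 d2 (T1 : measurableType d1) (T2 : measurableType d2) (R : realType).
Variables (m : {measure set T1 -> \bar R}) (mu : {measure set T2 -> \bar R}).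
Variables (phi : T2 -> T1) (E : set T2) (g : T2 -> R).
Hypothesis mphi : measurable_fun [set: T2] phi.
Hypothesis mE : measurable E.
Hypothesis mg : measurable_fun [set: T2] g.
Hypothesis g0 : forall x, 0 <= g x.
Hypothesis mle : forall A, measurable A ->
  (m A <= \int[mu]_(x in phi @^-1` A `&` E) (g x)%:E)%E.
Local Open Scope ereal_scope.

Import HBNNSimple.

Let mgE : measurable_fun E (EFin \o g).
Proof. by apply/measurable_EFinP; exact: measurable_funTS. Qed.

Let mcomp (f : T1 -> \bar R) : measurable_fun [set: T1] f ->
  measurable_fun E (fun x => f (phi x)).
Proof.
by move=> mf; apply: measurable_funTS; exact: (measurableT_comp mf mphi).
Qed.

(** A simple function is split along its level sets, to each of which the comparison of measures
    applies. *)
Let nnsfun_integral_density_le (h : {nnsfun T1 >-> R}) :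
  \int[m]_x (h x)%:E <= \int[mu]_(x in E) ((h (phi x))%:E * (g x)%:E).
Proof.
rewrite integralT_nnsfun sintegralE.
under eq_integral => x _.
  rewrite fimfunE -fsumEFin// ge0_mule_fsuml => [|y]; last exact: nnfun_muleindic_ge0.
  over.
have term0 y x : 0 <= (y * \1_(h @^-1` [set y]) (phi x))%:E * (g x)%:E.
  by rewrite mule_ge0 ?lee_fin//; exact: nnfun_muleindic_ge0.
have mi y : measurable_fun E (fun x => (\1_(h @^-1` [set y]) (phi x) : R)%:E).
  by apply: (mcomp (f := fun t => (\1_(h @^-1` [set y]) t)%:E)); exact/measurable_EFinP.
rewrite ge0_integral_fsum//; last first.
  move=> y; apply: emeasurable_funM => //.
  under eq_fun do rewrite EFinM.
  exact: measurable_funeM.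
apply: lee_fsum => // y [t _ <-].
under eq_integral do rewrite EFinM -muleA.
have mI : measurable_fun E (fun x => (\1_(h @^-1` [set h t]) (phi x))%:E * (g x)%:E).
  exact: emeasurable_funM.
rewrite ge0_integralZl//; last 2 first.
- by move=> x _; rewrite mule_ge0 ?lee_fin.
- by rewrite lee_fin.
apply: lee_wpmul2l; first by rewrite lee_fin.
apply: le_trans (mle _) _ => //.
rewrite le_eqVlt; apply/orP; left; apply/eqP.
rewrite setIC integral_mkcondr; apply: eq_integral => x _.
by rewrite epatch_indic /= muleC !indicE; congr ((nat_of_bool _)%:R%:E * _); apply/idP/idP; rewrite !inE.
Qed.

(** Simple approximations increase to [f], and monotone convergence carries the bound over. *)
Lemma integral_density_le (f : T1 -> \bar R) : measurable_fun [set: T1] f ->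
  (forall x, 0 <= f x) ->
  \int[m]_x f x <= \int[mu]_(x in E) (f (phi x) * (g x)%:E).
Proof.
move=> mf f0; pose h := nnsfun_approx measurableT mf.
have hf x : (h n x)%:E @[n --> \oo] --> f x by exact: cvg_nnsfun_approx.
have ndh x : {homo (fun n => (h n x)%:E) : n k / (n <= k)%N >-> n <= k}.
  by move=> a b ab; rewrite lee_fin; exact/lefP/nd_nnsfun_approx.
have hle n x : (h n x)%:E <= f x.
  by rewrite /h nnsfun_approxE; exact: le_approx.
rewrite (eq_integral (fun x => limn (fun n => (h n x)%:E))); last first.
  by move=> x _; apply/esym/cvg_lim => //; exact: hf.
have mh n : measurable_fun [set: T1] (fun x => (h n x)%:E) by exact/measurable_EFinP.
have h0 n x : [set: T1] x -> 0 <= (h n x)%:E by rewrite lee_fin.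
have ch := cvg_monotone_convergence (mu := m) measurableT mh h0 (fun x _ => ndh x).
apply: (cvge_to_le ch); near=> n.
apply: le_trans (nnsfun_integral_density_le _) _.
apply: ge0_le_integral => //.
- by move=> x _; rewrite mule_ge0 ?lee_fin.
- by apply: emeasurable_funM => //; exact: mcomp (mh n).
- by apply: emeasurable_funM => //; exact: mcomp mf.
- by move=> x _; apply: lee_wpmul2r; rewrite ?lee_fin.
Unshelve. all: by end_near. Qed.

End density_domination.

(** * The Plancherel density against the squared sine *)

Section plancherel_bound.
Context (R : realType) (q : nat).
Hypothesis q1 : (1 < q)%N.
Local Notation Q := (q%:R : R).

Lemma lnq_gt0 : 0 < ln Q.
Proof. by rewrite ln_gt0// ltr1n. Qed.

Lemma cpow_imagB (t : R) :
  normc (cpow Q (0 +i* t) - cpow Q (0 +i* - t)) ^+ 2 = 4 * sin (ln Q * t) ^+ 2.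
Proof.
rewrite !cpowE /= mul0r expR0 !mul1r mulNr cosN sinN subrr opprK expr0n add0r.
rewrite sqr_sqrtr ?sqr_ge0// [t * _]mulrC; ring.
Qed.

(** In [|c(s)|^-2] the factor [|q^(is) - q^(-is)|^2 = 4 sin^2(s log q)] is in the numerator, and the
    denominator is bounded below. Keeping the sine is what later gives a kernel of finite range. *)
Lemma plancherel_density_le : exists2 M : R, 0 <= M &
  forall s, plancherel_density q s <= M * sin (ln Q * s) ^+ 2.
Proof.
have l0 := lnq_gt0.
have n0 (z : R[i]) : 0 <= normc z by case: z => *; rewrite /= sqrtr_ge0.
(* The two terms in the numerator of [c] have moduli [q^(1/2)] and [q^(-1/2)], so their difference
   has modulus at least [D]. *)
pose D := expR (2^-1 * ln Q) - expR (- 2^-1 * ln Q).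
have D0 : 0 < D.
  by rewrite subr_gt0 ltr_expR ltr_pM2r// gtrN// invr_gt0.
have num_ge s : D <= normc (cpow Q (2^-1 +i* s) - cpow Q (- 2^-1 +i* - s)).
  rewrite /D -(normc_cpow q _ s) -(normc_cpow q _ (- s)) lerBlDr.
  by rewrite -{1}[cpow Q (2^-1 +i* s)](subrK (cpow Q (- 2^-1 +i* - s))) le_normcD.
set K := Num.sqrt Q / (Q + 1).
have cK0 : 0 <= cP R q * K ^- 2 by rewrite mulr_ge0 ?cP_ge0// invr_ge0 sqr_ge0.
exists (cP R q * K ^- 2 * (4 * D ^- 2)) => [|s].
  by rewrite mulr_ge0// mulr_ge0// invr_ge0 sqr_ge0.
rewrite /plancherel_density normc_cfun -/K.
(* With [0^-1 = 0] this holds also at [c = 0], so the endpoints of the interval need no separate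
   case. *)
have alg (k n c : R) : (k * (n / c)) ^- 2 = k ^- 2 * (c ^+ 2 / n ^+ 2).
  by rewrite -!exprVn !invfM invrK !exprMn [n^-1 ^+ 2 * _]mulrC.
rewrite alg cpow_imagB; move: (num_ge s); set n := normc _ => Dn.
rewrite mulrA -[leRHS]mulrA ler_wpM2l//.
rewrite [leRHS]mulrAC; apply: ler_wpM2l; first exact: mulr_ge0 (sqr_ge0 _).
have n_gt0 : 0 < n := lt_le_trans D0 Dn.
by rewrite lef_pV2 ?posrE ?exprn_gt0// lerXn2r// nnegrE ltW.
Qed.

Lemma integral_plancherel_le : exists2 M : R, 0 <= M &
  forall f : R -> R, measurable_fun [set: R] f -> (forall s, 0 <= f s) ->
  (\int[@plancherel R q]_s (f s)%:E <=
   M%:E * \int[lebesgue_measure]_(s in `[0%R, tau R q]) (f s * sin (ln Q * s) ^+ 2)%:E)%E.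
Proof.
have [M M0 densM] := plancherel_density_le; exists M => // f mf f0.
have mS : measurable_fun [set: R] (fun s => sin (ln Q * s) ^+ 2).
  have ms := continuous_measurable_fun (@continuous_sin R).
  apply: measurable_funX; apply: (measurableT_comp ms).
  exact: measurable_funM.
pose g s := M * sin (ln Q * s) ^+ 2.
have mg : measurable_fun [set: R] g by exact: measurable_funM.
have g0 s : 0 <= g s by rewrite mulr_ge0 ?sqr_ge0.
have mI : measurable (`[0, tau R q]%classic : set R) by exact: measurable_itv.
rewrite -ge0_integralZl//; last 2 first.
- by apply/measurable_EFinP/measurable_funTS/measurable_funM.
- by move=> s _; rewrite lee_fin mulr_ge0 ?sqr_ge0.
have -> : (\int[lebesgue_measure]_(s in `[0%R, tau R q]) (M%:E * (f s * sin (ln Q * s) ^+ 2)%:E) =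
  \int[lebesgue_measure]_(s in `[0%R, tau R q]) ((f s)%:E * (g s)%:E))%E.
  by apply: eq_integral => s _; rewrite -!EFinM /g mulrCA.
have mid : measurable_fun [set: measurableTypeR R] (idfun : R -> R) by exact: measurable_id.
apply: (integral_density_le (mu := lebesgue_measure) mid mI mg g0 _ (f := EFin \o f)) => //; last exact/measurable_EFinP.
move=> A mA; rewrite /= /plancherel; apply: ge0_le_integral => //.
- exact: measurableI.
- by move=> s _; rewrite lee_fin plancherel_density_ge0.
- by apply/measurable_EFinP/measurable_funTS; exact: measurable_plancherel_density.
- by apply/measurable_EFinP/measurable_funTS.
- by move=> s _; rewrite lee_fin.
Qed.

End plancherel_bound.

(** * Plancherel inequality *)

Section balls.
Context {q : nat} {X : htree q}.
Implicit Types (x y z : tvertex X).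

Lemma neighbours_seq x : exists2 A : seq (tvertex X), size A = q.+1 &
  forall y, adj x y -> y \in A.
Proof.
have An := @adj_regular q X x.
have /finite_fsetP[A AE] : finite_set [set y | adj x y] by exists q.+1.
move: An; rewrite AE => /card_eq_fsetP cA.
exists (enum_fset A); first exact: cA.
by move=> y xy; have : [set y | adj x y] y by []; rewrite AE.
Qed.

(** Schur's test needs a bound [N] independent of the centre; enlarging the radius by one adds at
    most [q + 1] neighbours for each point. *)
Lemma ball_seq n : exists N, forall x, exists2 B : seq (tvertex X),
  (size B <= N)%N & forall y, (dist x y <= n)%N -> y \in B.
Proof.
elim: n => [|n [N IHn]].
  exists 1%N => x; exists [:: x] => // y; rewrite leqn0 => /eqP/dist_eq0 ->.
  exact: mem_head.
exists (N + N * q.+1)%N => x; have [B BN xB] := IHn x.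
pose A z := s2val (cid2 (neighbours_seq z)).
have sA z : size (A z) = q.+1 by rewrite /A; case: cid2.
have adjA z y : adj z y -> y \in A z by rewrite /A; case: cid2 => ? ? /=; exact.
exists (B ++ flatten [seq A z | z <- B]).
  rewrite size_cat size_flatten /shape -map_comp (eq_map (g := fun=> q.+1)) => [|z]; last exact: sA.
  have -> : sumn [seq q.+1 | _ <- B] = (size B * q.+1)%N.
    by elim: (B) => //= _ B' ->; rewrite mulSn.
  by rewrite leq_add ?leq_mul.
move=> y; rewrite leq_eqVlt mem_cat => /orP[/eqP dy|/xB -> //].
have [z yz dz] : exists2 z, adj y z & (dist x z).+1 = dist x y.
  by apply: dist_closer => yx; move: dy; rewrite yx distxx.
apply/orP; right; apply/flattenP; exists (A z); last by apply: adjA; rewrite adj_sym.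
by apply: map_f; apply: xB; lia.
Qed.

Lemma ball_finite x n : finite_set [set y : tvertex X | (dist x y <= n)%N].
Proof.
have [N /(_ x)[B _ xB]] := ball_seq n.
by apply: (@sub_finite_set _ _ [set` B]); [exact: xB|exact: finite_seq].
Qed.

(** By [2 |f y f z| <= f y ^ 2 + f z ^ 2] the form is bounded by a sum of squares over near pairs.
    Each vertex has at most [N] near vertices, and each of the two squares contributes one [N]. *)
Lemma schur_test (R : realType) n (K : tvertex X -> tvertex X -> R) :
  (forall y z, `|K y z| <= 2) -> (forall y z, (n < dist y z)%N -> K y z = 0) ->
  exists N : nat, forall (s : seq (tvertex X)) (f : tvertex X -> R), uniq s ->
  \sum_(y <- s) \sum_(z <- s) f y * f z * K y z <= N%:R * \sum_(y <- s) f y ^+ 2.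
Proof.
move=> K2 K0; have [N ballN] := ball_seq n; exists (2 * N)%N => s f us.
pose near y z : R := (dist y z <= n)%:R.
apply: (@le_trans _ _ (\sum_(y <- s) \sum_(z <- s) (near y z * f y ^+ 2 + near z y * f z ^+ 2))).
  apply: ler_sum => y _; apply: ler_sum => z _.
  rewrite /near (dist_sym z y); case: leqP => [_|/K0 ->]; last by rewrite mulr0 !mul0r addr0.
  rewrite !mul1r; apply: (@le_trans _ _ (2 * `|f y * f z|)).
    by rewrite (le_trans (ler_norm _))// normrM mulrC ler_wpM2r.
  rewrite normrM -(real_normK (num_real (f y))) -(real_normK (num_real (f z))).
  by have := sqr_ge0 (`|f y| - `|f z|); lra.
have count_le y : \sum_(z <- s) near y z <= N%:R.
  rewrite /near -natr_sum ler_nat (eq_bigr (fun z => if (dist y z <= n)%N then 1%N else 0%N)); last first.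
    by move=> z _; case: ifP.
  rewrite -big_mkcond sum1_count -size_filter.
  have [B BN yB] := ballN y; apply: leq_trans BN; apply: uniq_leq_size.
    exact: filter_uniq.
  by move=> z; rewrite mem_filter => /andP[/yB].
under eq_bigr do rewrite big_split.
rewrite big_split /= [X in _ + X]exchange_big /= -mulr2n -[leLHS]mulr_natl natrM -mulrA.
rewrite ler_wpM2l// mulr_sumr; apply: ler_sum => y _.
by rewrite -mulr_suml ler_wpM2r// sqr_ge0.
Qed.

End balls.

(** * The quadratic form of the transform *)

Section plancherel_inequality.
Context {R : realType} {q : nat} {X : htree q}.
Implicit Types (x y z : tvertex X) (s : seq (tvertex X)) (w : ray X) (t : R).
Local Notation Q := (q%:R : R).
Local Notation hpow := (@hpow R q).
Local Notation pair_kernel := (@pair_kernel R q X).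
Variables (nu : probability (boundary X) R).
Hypothesis hnu : boundary_measure nu.

Definition pair_mass y z : R := \int[nu]_w pair_kernel y z w.

Lemma has_integral_pair_mass y z :
  has_integral nu setT (pair_kernel y z) (pair_mass y z).
Proof. by have [K [iK _] _] := has_integral_pair_kernel hnu y z; split. Qed.

Lemma pair_mass_far y z : (2 < dist y z)%N -> pair_mass y z = 0.
Proof. by have [K [_ <-]] := has_integral_pair_kernel hnu y z. Qed.

Lemma kappa_le2 k : `|kappa k : R| <= 2.
Proof.
rewrite /kappa; case: (k =P 0) => [->|_]; first by rewrite /= !subr0 mulr1 normr_nat.
by case: (k =P 2) => [->|_]; [rewrite /= mulr0|case: eqP => _; rewrite mulr0];
  rewrite ?subr0 ?sub0r ?normrN ?normr1 ?normr0 ?ler1n.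
Qed.

Lemma hpow_amgm (a b : int) : hpow (a + b) * 2 <= hpow (2 * a) + hpow (2 * b).
Proof.
have sq c : hpow (2 * c) = hpow c * hpow c by rewrite -hpowD; congr hpow; lia.
by rewrite hpowD !sq; have := sqr_ge0 (hpow a - hpow b); lra.
Qed.

(** [kappa] is at most 2 in modulus, the mixed power is at most the mean of the two Poisson kernels,
    and each of these has integral one. *)
Lemma pair_mass_le2 y z : `|pair_mass y z| <= 2.
Proof.
have [iK _] := has_integral_pair_mass y z.
have hy := has_integral_hpow hnu y; have hz := has_integral_hpow hnu z.
have [iD eD] := has_integralD measurableT hy hz.
apply: le_trans (le_normr_Rintegral measurableT iK) _.
rewrite -[leRHS]eD; apply: le_Rintegral => //.
  exact: (integrable_abse iK).
move=> w _; rewrite normrM (ger0_norm (x := hpow _)); last exact/ltW/hpow_gt0.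
apply: (@le_trans _ _ (hpow (iheight w y + iheight w z) * 2)).
  by rewrite ler_wpM2l ?kappa_le2// ltW// hpow_gt0.
exact: hpow_amgm.
Qed.

(** For real [f], this and [sin_sum] are the real and imaginary parts of the Fourier-Helgason
    transform, and [energy] is its squared modulus. *)
Definition cos_sum s (f : tvertex X -> R) (p : boundary X * R) : R :=
  \sum_(y <- s) f y * (hpow (iheight p.1 y) * cos ((iheight p.1 y)%:~R * (ln Q * p.2))).

Definition sin_sum s (f : tvertex X -> R) (p : boundary X * R) : R :=
  \sum_(y <- s) f y * (hpow (iheight p.1 y) * sin ((iheight p.1 y)%:~R * (ln Q * p.2))).

Definition energy s f p := cos_sum s f p ^+ 2 + sin_sum s f p ^+ 2.

Lemma energyE s f w t : energy s f (w, t) = \sum_(y <- s) \sum_(z <- s)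
  f y * f z * (hpow (iheight w y + iheight w z) *
    cos ((iheight w y - iheight w z)%:~R * (ln Q * t))).
Proof.
rewrite /energy /cos_sum /sin_sum /= !expr2 !mulr_suml -big_split /=.
apply: eq_bigr => y _; rewrite !mulr_sumr -big_split /=; apply: eq_bigr => z _.
by rewrite intrB mulrBl cosB hpowD; ring.
Qed.

Let measurable_height (y : tvertex X) :
  measurable_fun [set: boundary X * R] (fun p => (iheight p.1 y)%:~R : R).
Proof. exact: (measurableT_comp (measurable_iheight y) measurable_fst). Qed.

Let measurable_wave y (trig : R -> R) : continuous trig ->
  measurable_fun [set: boundary X * R]
    (fun p => hpow (iheight p.1 y) * trig ((iheight p.1 y)%:~R * (ln Q * p.2))).
Proof.
move=> /continuous_measurable_fun ct; apply: measurable_funM.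
  apply: measurableT_comp => //; apply: measurable_funM => //.
apply: (measurableT_comp ct); apply: measurable_funM => //.
by apply: measurable_funM => //; exact: measurable_snd.
Qed.

Lemma measurable_cos_sum s f : measurable_fun [set: boundary X * R] (cos_sum s f).
Proof.
apply: measurable_sum => y; apply: measurable_funM => //.
by apply: measurable_wave; exact: continuous_cos.
Qed.

Lemma measurable_sin_sum s f : measurable_fun [set: boundary X * R] (sin_sum s f).
Proof.
apply: measurable_sum => y; apply: measurable_funM => //.
by apply: measurable_wave; exact: continuous_sin.
Qed.

Lemma measurable_energy s f : measurable_fun [set: boundary X * R] (energy s f).
Proof.
apply: measurable_funD; apply: measurable_funX.
  exact: measurable_cos_sum.
exact: measurable_sin_sum.
Qed.

Lemma energy_ge0 s f p : 0 <= energy s f p.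
Proof. by rewrite addr_ge0 ?sqr_ge0. Qed.

(** The Plancherel inequality for real functions. By Tonelli the [s]-integral comes first and turns
    each cosine into [kappa]; the integral over rays then leaves the form with kernel [pair_mass],
    to which Schur's test applies. *)
Lemma integral_energy_le : exists2 B : R, 0 <= B &
  forall s f, uniq s -> (\int[nu \x @plancherel R q]_p (energy s f p)%:E <=
    (B * \sum_(y <- s) f y ^+ 2)%:E)%E.
Proof.
have q1 : (1 < q)%N := htree_ge2 X; have l0 := lnq_gt0 R q1.
have [M M0 intM] := integral_plancherel_le R q1.
have [N schurN] := schur_test pair_mass_le2 pair_mass_far.
have tau0 : 0 <= tau R q by rewrite divr_ge0 ?pi_ge0 ?ltW.
(* [M] comes from the density, [tau / 4] from the trigonometric integral and [N] from Schur's
   test. *)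
exists (M * (tau R q / 4 * N%:R)) => [|s f us].
  by rewrite mulr_ge0// mulr_ge0// divr_ge0.
rewrite fubini_tonelli1; last 2 first.
- by apply/measurable_EFinP; exact: measurable_energy.
- by move=> p; rewrite lee_fin energy_ge0.
pose G w := \sum_(y <- s) \sum_(z <- s) f y * f z * pair_kernel y z w.
have iG : has_integral nu setT (fun w => M * (tau R q / 4 * G w))
    (M * (tau R q / 4 * \sum_(y <- s) \sum_(z <- s) f y * f z * pair_mass y z)).
  do 2 apply: has_integralZ => //.
  apply: has_integral_sum => // y; apply: has_integral_sum => // z.
  by apply: has_integralZ => //; exact: has_integral_pair_mass.
apply: (@le_trans _ _ (\int[nu]_w (M * (tau R q / 4 * G w))%:E)%E); last first.
  rewrite (has_integral_EFin measurableT iG) lee_fin -[leRHS]mulrA -[X in _ <= M * X]mulrA.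
  apply: ler_wpM2l => //; apply: ler_wpM2l; first exact: divr_ge0.
  exact: schurN.
have sliceG w : has_integral lebesgue_measure `[0, tau R q]%classic
    (fun t => energy s f (w, t) * sin (ln Q * t) ^+ 2) (tau R q / 4 * G w).
  rewrite (_ : (fun _ => _) = fun t => \sum_(y <- s) \sum_(z <- s)
      f y * f z * hpow (iheight w y + iheight w z) *
      (cos ((iheight w y - iheight w z)%:~R * (ln Q * t)) * sin (ln Q * t) ^+ 2)).
    apply: has_integral_cond.
      apply: has_integral_sum => // y; apply: has_integral_sum => // z.
      by apply: has_integralZ => //; exact: has_integral_cos_sin2.
    rewrite /G mulr_sumr; apply: eq_bigr => y _; rewrite mulr_sumr.
    by apply: eq_bigr => z _; rewrite /pair_kernel /tau; ring.
  apply/funext => t; rewrite energyE mulr_suml; apply: eq_bigr => y _.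
  by rewrite mulr_suml; apply: eq_bigr => z _; ring.
have mslice w : measurable_fun [set: R] (fun t => energy s f (w, t)).
  have := (measurable_fun_pair2 (w : boundary X) (measurable_energy s f)). exact.
apply: ge0_le_integral => //.
- by move=> w _; apply: integral_ge0 => t _; rewrite lee_fin energy_ge0.
- apply: (measurable_fun_fubini_tonelli_F (m2 := @plancherel R q) (EFin \o energy s f)).
    by apply/measurable_EFinP; exact: measurable_energy.
  by move=> p; rewrite lee_fin energy_ge0.
- by case: iG => iGi _; exact: (measurable_int nu iGi).
- move=> w _; apply: le_trans (intM _ (mslice w) _) _.
    by move=> t; exact: energy_ge0.
  by rewrite (has_integral_EFin _ (sliceG w))// EFinM.
Qed.

End plancherel_inequality.

(** * Complex-valued integrals *)

Section complex_modulus.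
Context {R : realType}.
Implicit Types z u : R[i].
Local Notation Re := complex.Re.
Local Notation Im := complex.Im.

Lemma normc_ge0 z : 0 <= normc z.
Proof. by case: z => a b /=; rewrite sqrtr_ge0. Qed.

Lemma sqr_normc z : normc z ^+ 2 = Re z ^+ 2 + Im z ^+ 2.
Proof. by case: z => a b /=; rewrite sqr_sqrtr// addr_ge0 ?sqr_ge0. Qed.

Lemma normc_sqrt z : normc z = Num.sqrt (Re z ^+ 2 + Im z ^+ 2).
Proof. by case: z. Qed.

Lemma ReD z u : Re (z + u) = Re z + Re u. Proof. by case: z; case: u. Qed.

Lemma ImD z u : Im (z + u) = Im z + Im u. Proof. by case: z; case: u. Qed.

Lemma ReM z u : Re (z * u) = Re z * Re u - Im z * Im u.
Proof. by case: z; case: u. Qed.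

Lemma ImM z u : Im (z * u) = Re z * Im u + Im z * Re u.
Proof. by case: z; case: u. Qed.

Lemma complex_eq z u : Re z = Re u -> Im z = Im u -> z = u.
Proof. by case: z => a b; case: u => c d /= -> ->. Qed.

Lemma Re_le_normc z : `|Re z| <= normc z.
Proof.
by rewrite normc_sqrt -sqrtr_sqr ler_sqrt ?addr_ge0 ?sqr_ge0// lerDl sqr_ge0.
Qed.

Lemma Im_le_normc z : `|Im z| <= normc z.
Proof.
by rewrite normc_sqrt -sqrtr_sqr ler_sqrt ?addr_ge0 ?sqr_ge0// lerDr sqr_ge0.
Qed.

Lemma normc_le_ReIm z : normc z <= `|Re z| + `|Im z|.
Proof.
rewrite -(@ler_pXn2r _ 2) ?nnegrE ?normc_ge0 ?addr_ge0// sqr_normc.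
rewrite -(real_normK (num_real (Re z))) -(real_normK (num_real (Im z))).
have : 0 <= `|Re z| * `|Im z| by rewrite mulr_ge0.
by lra.
Qed.

End complex_modulus.

Section complex_integral.
Context d (T : measurableType d) (R : realType).
Variables (m : {measure set T -> \bar R}) (D : set T).
Hypothesis mD : measurable D.
Implicit Types (F G : T -> R[i]) (a b c : R[i]).
Local Notation Re := complex.Re.
Local Notation Im := complex.Im.

Lemma cmeasurable_funD F G : cmeasurable_fun D F -> cmeasurable_fun D G ->
  cmeasurable_fun D (fun t => F t + G t).
Proof.
move=> [rF iF] [rG iG]; split.
- by under eq_fun do rewrite ReD; exact: measurable_funD.
- by under eq_fun do rewrite ImD; exact: measurable_funD.
Qed.

Lemma cmeasurable_funM F G : cmeasurable_fun D F -> cmeasurable_fun D G ->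
  cmeasurable_fun D (fun t => F t * G t).
Proof.
move=> [rF iF] [rG iG]; split.
- by under eq_fun do rewrite ReM; apply: measurable_funB; exact: measurable_funM.
- by under eq_fun do rewrite ImM; apply: measurable_funD; exact: measurable_funM.
Qed.

Lemma cmeasurable_cst c : cmeasurable_fun D (fun=> c).
Proof. by split; exact: measurable_cst. Qed.

Lemma measurable_normc F : cmeasurable_fun D F ->
  measurable_fun D (fun t => normc (F t)).
Proof.
move=> [rF iF]; under eq_fun do rewrite normc_sqrt.
apply: (measurableT_comp (continuous_measurable_fun (@sqrt_continuous R))).
by apply: measurable_funD; exact: measurable_funX.
Qed.

Lemma cintegrable_Re F : cintegrable m D F -> m.-integrable D (EFin \o (fun t => Re (F t))).
Proof.
move=> [mF iF]; have [rF _] := mF; apply/integrableP; split.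
  exact/measurable_EFinP.
apply: le_lt_trans iF; apply: ge0_le_integral => //.
- by apply: measurableT_comp => //; exact/measurable_EFinP.
- exact/measurable_EFinP/measurable_normc.
- by move=> t _; rewrite lee_fin Re_le_normc.
Qed.

Lemma cintegrable_Im F : cintegrable m D F -> m.-integrable D (EFin \o (fun t => Im (F t))).
Proof.
move=> [mF iF]; have [_ rF] := mF; apply/integrableP; split.
  exact/measurable_EFinP.
apply: le_lt_trans iF; apply: ge0_le_integral => //.
- by apply: measurableT_comp => //; exact/measurable_EFinP.
- exact/measurable_EFinP/measurable_normc.
- by move=> t _; rewrite lee_fin Im_le_normc.
Qed.

Lemma cintegrableD F G : cintegrable m D F -> cintegrable m D G ->
  cintegrable m D (fun t => F t + G t).
Proof.
move=> [mF iF] [mG iG]; split; first exact: cmeasurable_funD.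
have nF := measurable_normc mF; have nG := measurable_normc mG.
apply: (@le_lt_trans _ _ (\int[m]_(t in D) ((normc (F t))%:E + (normc (G t))%:E))%E).
  apply: ge0_le_integral => //.
  - by move=> t _; rewrite lee_fin normc_ge0.
  - by apply/measurable_EFinP/measurable_normc/cmeasurable_funD.
  - by apply: emeasurable_funD; exact/measurable_EFinP.
  - by move=> t _; rewrite -EFinD lee_fin le_normcD.
rewrite ge0_integralD//.
- exact: lte_add_pinfty.
- by move=> t _; rewrite lee_fin normc_ge0.
- exact/measurable_EFinP.
- by move=> t _; rewrite lee_fin normc_ge0.
- exact/measurable_EFinP.
Qed.

Lemma cintegrableZ c F : cintegrable m D F -> cintegrable m D (fun t => c * F t).
Proof.
move=> [mF iF]; have nF := measurable_normc mF.
split; first exact: cmeasurable_funM (cmeasurable_cst c) mF.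
under eq_integral do rewrite normcM EFinM.
rewrite ge0_integralZl//.
- by rewrite lte_mul_pinfty ?lee_fin ?normc_ge0.
- exact/measurable_EFinP.
- by move=> t _; rewrite lee_fin normc_ge0.
- by rewrite lee_fin normc_ge0.
Qed.

Lemma cintegralD F G : cintegrable m D F -> cintegrable m D G ->
  cintegral m D (fun t => F t + G t) = cintegral m D F + cintegral m D G.
Proof.
move=> iF iG; apply: complex_eq; rewrite ?ReD ?ImD /=.
- under eq_Rintegral do rewrite ReD.
  by rewrite RintegralD//; exact: cintegrable_Re.
- under eq_Rintegral do rewrite ImD.
  by rewrite RintegralD//; exact: cintegrable_Im.
Qed.

Lemma cintegralZ c F : cintegrable m D F ->
  cintegral m D (fun t => c * F t) = c * cintegral m D F.
Proof.
move=> iF; have rF := cintegrable_Re iF; have mF := cintegrable_Im iF.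
have Zr (k : R) f : m.-integrable D (EFin \o f) -> m.-integrable D (EFin \o (fun t => k * f t)).
  by move=> fi; exact: (integrableZl mD k fi).
apply: complex_eq; rewrite ?ReM ?ImM /=.
- under eq_Rintegral do rewrite ReM.
  by rewrite RintegralB ?RintegralZl//; exact: Zr.
- under eq_Rintegral do rewrite ImM.
  by rewrite RintegralD ?RintegralZl//; exact: Zr.
Qed.

Lemma cintegral_sum (I : Type) (s : seq I) (c : I -> R[i]) (F : I -> T -> R[i]) :
  (forall i, cintegrable m D (F i)) ->
  cintegrable m D (fun t => \sum_(i <- s) c i * F i t) /\
  cintegral m D (fun t => \sum_(i <- s) c i * F i t) =
    \sum_(i <- s) c i * cintegral m D (F i).
Proof.
move=> iF; elim: s => [|i s [IH1 IH2]].
  under eq_fun do rewrite big_nil; rewrite big_nil; split.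
    split; first exact: cmeasurable_cst.
    by under eq_integral do rewrite normc0; rewrite integral0 ltry.
  by apply: complex_eq; rewrite /= Rintegral_cst// mul0r.
under eq_fun do rewrite big_cons; rewrite big_cons; split.
  by apply: cintegrableD => //; exact: cintegrableZ.
by rewrite cintegralD ?cintegralZ ?IH2//; exact: cintegrableZ.
Qed.

(** Real and imaginary parts are estimated separately, which costs the factor 2. *)
Lemma normc_cintegral_le F : cintegrable m D F ->
  ((normc (cintegral m D F))%:E <= 2%:E * \int[m]_(t in D) (normc (F t))%:E)%E.
Proof.
move=> iF; have rF := cintegrable_Re iF; have mF := cintegrable_Im iF.
have [cF fin] := iF; have nF := measurable_normc cF.
have nI : m.-integrable D (EFin \o (fun t => normc (F t))).
  apply/integrableP; split; first exact/measurable_EFinP.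
  by under eq_integral do rewrite /= ger0_norm ?normc_ge0//.
have <- : (\int[m]_(t in D) normc (F t))%:E = (\int[m]_(t in D) (normc (F t))%:E)%E.
  by rewrite /Rintegral fineK// integrable_fin_num.
rewrite -EFinM lee_fin (le_trans (normc_le_ReIm _))// mulr_natl mulr2n /=.
apply: lerD; (apply: le_trans (le_normr_Rintegral mD _) _; first by []).
  by apply: le_Rintegral => // [|t _]; [exact: integrable_abse rF|exact: Re_le_normc].
by apply: le_Rintegral => // [|t _]; [exact: integrable_abse mF|exact: Im_le_normc].
Qed.

End complex_integral.

(** * Fourier-Helgason transform and symbols *)

Section fourier_bound.
Context {R : realType} {q : nat} {X : htree q}.
Implicit Types (x y z : tvertex X) (s : seq (tvertex X)) (f : tvertex X -> R[i]).
Implicit Types (p : boundary X * R).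
Local Notation Q := (q%:R : R).
Local Notation hpow := (@hpow R q).
Local Notation Re := complex.Re.
Local Notation Im := complex.Im.
Variables (nu : probability (boundary X) R).
Hypothesis hnu : boundary_measure nu.
Local Notation phase_measure := (nu \x @plancherel R q)%E.

Definition wave y p : R[i] :=
  cpow Q (((2^-1)%:C + 'i * p.2%:C) * (height R p.1 y)%:C).

Definition fourier s f p : R[i] := \sum_(y <- s) f y * wave y p.

Lemma cpow_height (a : R) (w : ray X) y :
  cpow Q (((2^-1)%:C + 'i * a%:C) * (height R w y)%:C) =
  (hpow (iheight w y) * cos ((iheight w y)%:~R * (ln Q * a))) +i*
  (hpow (iheight w y) * sin ((iheight w y)%:~R * (ln Q * a))).
Proof.
rewrite heightE (_ : _ * _ = (2^-1 * (iheight w y)%:~R) +i* (a * (iheight w y)%:~R)); last first.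
  by apply: complex_eq; rewrite ?ReM ?ImM /=; ring.
rewrite cpowE /hpow.
rewrite (_ : 2^-1 * (iheight w y)%:~R * ln Q = (iheight w y)%:~R * (ln Q / 2)); last by ring.
by rewrite (_ : a * (iheight w y)%:~R * ln Q = (iheight w y)%:~R * (ln Q * a)); last by ring.
Qed.

Lemma fourierE s f p : fourier s f p =
  (cos_sum s (fun y => Re (f y)) p - sin_sum s (fun y => Im (f y)) p) +i*
  (sin_sum s (fun y => Re (f y)) p + cos_sum s (fun y => Im (f y)) p).
Proof.
rewrite /fourier /cos_sum /sin_sum; elim: s => [|y s IHs].
  by rewrite !big_nil subr0 addr0.
rewrite !big_cons IHs; apply: complex_eq; rewrite ?ReD ?ImD ?ReM ?ImM /wave cpow_height /=; ring.
Qed.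

(** By linearity the transform of [f] is that of its real part plus [i] times that of its imaginary
    part; the square of the sum costs the factor 2. *)
Lemma sqr_fourier_le s f p : normc (fourier s f p) ^+ 2 <=
  2 * (energy s (fun y => Re (f y)) p + energy s (fun y => Im (f y)) p).
Proof.
rewrite sqr_normc fourierE /= /energy.
move: (cos_sum _ _ _) (sin_sum _ _ _) (cos_sum _ _ _) (sin_sum _ _ _) => a b c d.
have := sqr_ge0 (c + d); have := sqr_ge0 (a - b); lra.
Qed.

Lemma cmeasurable_fourier s f : cmeasurable_fun [set: boundary X * R] (fourier s f).
Proof.
rewrite (funext (fourierE s f)); split => /=.
  by apply: measurable_funB; [exact: measurable_cos_sum|exact: measurable_sin_sum].
by apply: measurable_funD; [exact: measurable_sin_sum|exact: measurable_cos_sum].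
Qed.

Lemma phase_measureT : phase_measure setT = (@plancherel R q) setT.
Proof.
rewrite -setXTT product_measure1E// -[RHS]mul1e; congr (_ * _)%E.
exact: probability_setT.
Qed.

Definition norm2 s f : R := Num.sqrt (\sum_(y <- s) normc (f y) ^+ 2).

Lemma sqr_norm2 s f : norm2 s f ^+ 2 = \sum_(y <- s) normc (f y) ^+ 2.
Proof. by rewrite sqr_sqrtr// sumr_ge0// => y _; exact: sqr_ge0. Qed.

Lemma norm2_eq0 s f y : norm2 s f = 0 -> y \in s -> f y = 0.
Proof.
move=> n0 ys; have := sqr_norm2 s f; rewrite n0 expr0n /= => /esym/eqP.
rewrite psumr_eq0; last by move=> z _; exact: sqr_ge0.
by move=> /allP/(_ _ ys) /=; rewrite sqrf_eq0 => /eqP/eq0_normc.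
Qed.

(* AM-GM: |F| <= S/2 + |F|^2/(2S) with S the l2 norm of f, and then Plancherel. *)
Lemma integral_fourier_le : exists2 K : R, 0 <= K &
  forall s f, uniq s -> (\int[phase_measure]_p (normc (fourier s f p))%:E <=
    (K * norm2 s f)%:E)%E.
Proof.
have [B B0 intB] := integral_energy_le hnu.
set M := fine ((@plancherel R q) setT).
have ME : phase_measure setT = M%:E.
  by rewrite phase_measureT fineK// fin_num_measure.
have M0 : 0 <= M by rewrite fine_ge0.
(* [M / 2] comes from integrating the constant [S / 2] over a space of mass [M], and [B] from the
   energies of the real and imaginary parts. *)
exists (M / 2 + B) => [|s f us]; first by rewrite addr_ge0// divr_ge0.
have [S0|S0] := eqVneq (norm2 s f) 0.
  rewrite S0 mulr0 integral0_eq// => p _.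
  rewrite /fourier big_seq big1 ?normc0// => y ys.
  by rewrite (norm2_eq0 S0 ys) mul0r.
have Sp : 0 < norm2 s f by rewrite lt_def S0 sqrtr_ge0.
set S := norm2 s f in Sp *; set fr := fun y => Re (f y); set fi := fun y => Im (f y).
have Sv0 : 0 <= S^-1 by rewrite invr_ge0 ltW.
have mE g : measurable_fun setT (fun p => S^-1%:E * (energy s g p)%:E)%E.
  by apply: measurable_funeM; apply/measurable_EFinP; exact: measurable_energy.
have E0 g p : (0 <= S^-1%:E * (energy s g p)%:E)%E.
  by rewrite -EFinM lee_fin mulr_ge0 ?energy_ge0.
have intE g : (\int[phase_measure]_p (S^-1%:E * (energy s g p)%:E) <=
    (S^-1 * (B * \sum_(y <- s) g y ^+ 2))%:E)%E.
  rewrite ge0_integralZl ?lee_fin//.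
  - by rewrite EFinM; apply: lee_wpmul2l; [rewrite lee_fin|exact: intB].
  - by apply/measurable_EFinP; exact: measurable_energy.
  - by move=> p _; rewrite lee_fin energy_ge0.
apply: (@le_trans _ _ (\int[phase_measure]_p ((S / 2)%:E +
    (S^-1%:E * (energy s fr p)%:E + S^-1%:E * (energy s fi p)%:E)))%E).
  apply: ge0_le_integral => //.
  - by move=> p _; rewrite lee_fin normc_ge0.
  - by apply/measurable_EFinP/measurable_normc; exact: cmeasurable_fourier.
  - by apply: emeasurable_funD => //; exact: emeasurable_funD.
  move=> p _; rewrite -!EFinM -!EFinD lee_fin -mulrDr.
  have := sqr_fourier_le s f p; rewrite -/fr -/fi.
  move: (energy s fr p + energy s fi p) (normc _) => E n En.
  rewrite -(ler_pM2l Sp) mulrDr !mulrA divff ?gt_eqF// mul1r.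
  by have := sqr_ge0 (S - n); lra.
rewrite ge0_integralD//; last 3 first.
- by move=> p _; rewrite lee_fin divr_ge0// ltW.
- by move=> p _; rewrite adde_ge0.
- exact: emeasurable_funD.
rewrite ge0_integralD// integral_cst// [X in (_ * X)%E]ME -EFinM.
apply: le_trans (leeD (lexx _) (leeD (intE fr) (intE fi))) _.
rewrite -!EFinD lee_fin -mulrDr -mulrDr -big_split /=.
rewrite (eq_bigr (fun y => normc (f y) ^+ 2)) => [|y _]; last by rewrite sqr_normc.
rewrite -sqr_norm2 -/S le_eqVlt; apply/orP; left; apply/eqP; field.
by rewrite gt_eqF.
Qed.

(** * Integrating the transform against a bounded amplitude *)

Section symbol.
Variables (sigma : tvertex X * boundary X * R -> R[i]).
Hypothesis msigma : measurable_symbol sigma.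

Definition amplitude x p : R[i] :=
  cpow Q (((2^-1)%:C - 'i * p.2%:C) * (height R p.1 x)%:C) * sigma (x, p.1, p.2).

(** The factor [q^(-i s h)] has modulus one, so the bound assumed on the symbol is a bound on the
    amplitude. *)
Lemma normc_amplitude x p : normc (amplitude x p) =
  normc (cpow Q ((2^-1 * height R p.1 x)%:C) * sigma (x, p.1, p.2)).
Proof.
rewrite /amplitude !normcM; congr (_ * _).
rewrite (_ : _ * _ = (2^-1 * height R p.1 x) +i* (- p.2 * height R p.1 x)).
  by rewrite !normc_cpow.
by apply: complex_eq; rewrite ?ReM ?ImM /=; ring.
Qed.

Lemma measurable_phase_space : measurable (@phase_space R q X).
Proof. by apply: measurableX => //; exact: measurable_itv. Qed.

Lemma cmeasurable_amplitude x : cmeasurable_fun phase_space (amplitude x).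
Proof.
apply: cmeasurable_funM.
  (* This factor is the complex conjugate of the wave at [x], so its parts are one-point instances
     of [cos_sum] and [sin_sum]. *)
  have E p : cpow Q (((2^-1)%:C - 'i * p.2%:C) * (height R p.1 x)%:C) =
     (cos_sum [:: x] (fun=> 1) p) +i* (- sin_sum [:: x] (fun=> 1) p).
    rewrite (_ : (2^-1)%:C - 'i * p.2%:C = (2^-1)%:C + 'i * (- p.2)%:C); last first.
      by apply: complex_eq; rewrite ?ReM ?ImM /=; ring.
    by rewrite cpow_height /cos_sum /sin_sum !big_seq1 !mulrN cosN sinN !mul1r mulrN.
  rewrite (funext E); split; apply: measurable_funTS => /=.
    exact: measurable_cos_sum.
  by apply: measurableT_comp => //; exact: measurable_sin_sum.
have mF : measurable ([set: tvertex X * boundary X] `*` `[0, tau R q]%classic).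
  by apply: measurableX => //; exact: measurable_itv.
have mg : measurable_fun phase_space
    (fun p : boundary X * R => ((x, p.1), p.2) : (tvertex X * boundary X) * R).
  apply: measurable_funTS; apply: measurable_fun_pair => //.
  exact: measurable_fun_pair.
have [rs is_] := msigma; split.
- by apply: (measurable_comp mF _ rs mg) => _ [p [_ pI] <-].
- by apply: (measurable_comp mF _ is_ mg) => _ [p [_ pI] <-].
Qed.

(** The amplitude is bounded by [c] almost everywhere and the transform is bounded in [L^1]; the
    factor 2 is that of [normc_cintegral_le]. *)
Lemma amplitude_fourier_bound (K c : R) x : 0 <= c ->
    (forall s f, uniq s -> (\int[phase_measure]_p (normc (fourier s f p))%:E <=
      (K * norm2 s f)%:E)%E) ->
    {ae phase_measure, forall p, phase_space p -> normc (amplitude x p) <= c} ->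
  forall s f, uniq s ->
    cintegrable phase_measure phase_space (fun p => amplitude x p * fourier s f p) /\
    normc (cintegral phase_measure phase_space (fun p => amplitude x p * fourier s f p))
      <= 2 * K * c * norm2 s f.
Proof.
move=> c0 intF aeb s f us.
have mP := measurable_phase_space.
have mF := cmeasurable_fourier s f.
have mFP : cmeasurable_fun phase_space (fourier s f).
  by case: mF => rF iF; split; exact: measurable_funTS.
have mG : cmeasurable_fun phase_space (fun p => amplitude x p * fourier s f p).
  by apply: cmeasurable_funM => //; exact: cmeasurable_amplitude.
have bnd : (\int[phase_measure]_(p in phase_space)
    (normc (amplitude x p * fourier s f p))%:E <= (c * (K * norm2 s f))%:E)%E.
  apply: (@le_trans _ _ (\int[phase_measure]_(p in phase_space)
      (c%:E * (normc (fourier s f p))%:E))%E).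
    apply: ae_ge0_le_integral => //.
    - by move=> p _; rewrite lee_fin normc_ge0.
    - exact/measurable_EFinP/measurable_normc.
    - by move=> p _; rewrite mule_ge0 ?lee_fin ?normc_ge0.
    - by apply: measurable_funeM; exact/measurable_EFinP/measurable_normc.
    apply: filterS aeb => p H Pp.
    by rewrite -EFinM lee_fin normcM ler_wpM2r ?normc_ge0 ?H.
  rewrite ge0_integralZl//; last 2 first.
  - exact/measurable_EFinP/measurable_normc.
  - by move=> p _; rewrite lee_fin normc_ge0.
  rewrite [in leRHS]EFinM; apply: lee_wpmul2l; first by rewrite lee_fin.
  apply: le_trans (intF s f us); apply: ge0_subset_integral => //.
  - by apply/measurable_EFinP/measurable_normc.
  - by move=> p _; rewrite lee_fin normc_ge0.
have iG : cintegrable phase_measure phase_space (fun p => amplitude x p * fourier s f p).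
  by split => //; apply: le_lt_trans bnd _; rewrite ltry.
split=> //; rewrite -lee_fin; apply: le_trans (normc_cintegral_le mP iG) _.
apply: le_trans (lee_wpmul2l _ bnd) _; first by rewrite lee_fin.
by rewrite -EFinM lee_fin le_eqVlt; apply/orP; left; apply/eqP; ring.
Qed.

End symbol.
End fourier_bound.

(** * Extension to square summable functions *)

Section square_summable.
Context {R : realType} {q : nat} {X : htree q}.
Implicit Types (x y z : tvertex X) (s : seq (tvertex X)) (f g : tvertex X -> R[i]).
Local Notation Re := complex.Re.
Local Notation Im := complex.Im.
Local Notation cnt := (@counting (tvertex X) R).

Lemma measurable_from_tvertex d (T : measurableType d) (D : set (tvertex X))
  (f : tvertex X -> T) : measurable_fun D f.
Proof. by move=> _ Y _. Qed.

Lemma counting_set1 y : cnt [set y] = 1%E.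
Proof.
by rewrite /counting asboolT ?fset_set1 ?cardfs1//; exact: finite_set1.
Qed.

Lemma integral_counting_seq s (g : tvertex X -> R) : uniq s ->
  (forall y, 0 <= g y) ->
  (\int[cnt]_(y in [set` s]) (g y)%:E)%E = (\sum_(y <- s) g y)%:E.
Proof.
move=> + g0; elim: s => [_|y s IHs /= /andP[ys us]].
  by rewrite big_nil set_nil integral_set0.
have -> : [set` y :: s] = [set y] `|` [set` s].
  by apply/seteqP; split=> z /=; rewrite in_cons; [case/predU1P => [->|]; [left|right]|case=> [->|->]; rewrite ?eqxx ?orbT].
rewrite big_cons ge0_integral_setU//.
- rewrite IHs// EFinD; congr (_ + _)%E.
  rewrite (eq_integral (cst (g y)%:E)).
    rewrite integral_cst// -[RHS]mule1; congr (_ * _)%E.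
    exact: counting_set1.
  by move=> z /set_mem ->.
- by move=> z _; rewrite lee_fin.
- by apply/disj_setPS => z [/= -> zs]; rewrite zs in ys.
Qed.

(** Balls are finite and exhaust the tree, so monotone convergence reaches the whole integral from
    finite sums. *)
Lemma integral_counting_le (g : tvertex X -> R) (c : R) : (forall y, 0 <= g y) ->
  (forall s, uniq s -> \sum_(y <- s) g y <= c) ->
  (\int[cnt]_y (g y)%:E <= c%:E)%E.
Proof.
move=> g0 gc; pose B n := [set y : tvertex X | (dist (Defs.root X : tvertex X) y <= n)%N].
have BT : \bigcup_n B n = setT.
  by apply/seteqP; split=> // y _; exists (dist (Defs.root X : tvertex X) y) => //=; exact: leqnn.
rewrite -BT.
have cvgB : (\int[cnt]_(y in B n) (g y)%:E @[n --> \oo] -->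
    \int[cnt]_(y in \bigcup_n B n) (g y)%:E)%E.
  apply: ge0_nondecreasing_set_cvg_integral => //.
  - by move=> n m nm; apply/subsetPset => y /= /leq_trans; exact.
  - by move=> n y _; rewrite lee_fin.
apply: (cvge_to_le cvgB); near=> n.
have finB : finite_set (B n) by exact: ball_finite.
rewrite -(fset_setK finB) integral_counting_seq// ?fset_uniq//.
by rewrite lee_fin; apply: gc; exact: fset_uniq.
Unshelve. all: by end_near. Qed.

Lemma L2norm_ge0 f : (0 <= L2norm f)%E.
Proof. exact: Lnorm_ge0. Qed.

Let powE (f : tvertex X -> R[i]) y : (`| (normc (f y))%:E | `^ 2 = (normc (f y) ^+ 2)%:E)%E.
Proof. by rewrite /= ger0_norm ?normc_ge0// powR_mulrn ?normc_ge0. Qed.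

Lemma L2norm_le f (c : R) : 0 <= c ->
  (L2norm f <= c%:E)%E <-> (\int[cnt]_y (normc (f y) ^+ 2)%:E <= (c ^+ 2)%:E)%E.
Proof.
move=> c0; have E0 : (0 <= \int[cnt]_y (normc (f y) ^+ 2)%:E)%E.
  by apply: integral_ge0 => y _; rewrite lee_fin sqr_ge0.
split=> [fc|fc].
  have <- : (L2norm f `^ 2 = \int[cnt]_y (normc (f y) ^+ 2)%:E)%E.
    by rewrite /L2norm poweR_Lnorm//; apply: eq_integral => y _; rewrite powE.
  rewrite (_ : (c ^+ 2)%:E = c%:E `^ 2)%E; last by rewrite poweR_EFin powR_mulrn.
  apply: gt0_ler_poweR => //; rewrite in_itv/= leey andbT ?lee_fin//.
  exact: L2norm_ge0.
rewrite /L2norm unlock /Lnorm.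
rewrite (eq_integral (fun y => (normc (f y) ^+ 2)%:E)); last by move=> y _; rewrite powE.
rewrite (_ : c%:E = (c ^+ 2)%:E `^ 2^-1)%E; last first.
  by rewrite poweR_EFin powR12_sqrt ?sqr_ge0// sqrtr_sqr ger0_norm.
by apply: gt0_ler_poweR; rewrite ?invr_ge0// in_itv/= leey andbT ?lee_fin ?sqr_ge0.
Qed.

Lemma inL2_norm f : inL2 f -> exists2 n : R, 0 <= n & L2norm f = n%:E.
Proof.
move=> fin; exists (fine (L2norm f)); first by rewrite fine_ge0 ?L2norm_ge0.
by rewrite fineK// ge0_fin_numE// L2norm_ge0.
Qed.

Lemma L2norm_le_scale f g (c : R) : 0 <= c -> inL2 g ->
  (forall y, normc (f y) <= c * normc (g y)) -> (L2norm f <= c%:E * L2norm g)%E.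
Proof.
move=> c0 /inL2_norm[n n0 gn] fg; rewrite gn -EFinM.
have /(L2norm_le g n0) g2 : (L2norm g <= n%:E)%E by rewrite gn.
apply/L2norm_le; first exact: mulr_ge0.
apply: (@le_trans _ _ (\int[cnt]_y ((c ^+ 2)%:E * (normc (g y) ^+ 2)%:E))%E).
  apply: ge0_le_integral => //.
  - by move=> y _; rewrite lee_fin sqr_ge0.
  - move=> y _; rewrite -EFinM lee_fin -exprMn lerXn2r// nnegrE ?mulr_ge0 ?normc_ge0//.
rewrite ge0_integralZl//.
- by rewrite exprMn [leRHS]EFinM; apply: lee_wpmul2l; rewrite ?lee_fin ?sqr_ge0.
- by move=> y _; rewrite lee_fin sqr_ge0.
- by rewrite lee_fin sqr_ge0.
Qed.

Lemma L2_hoelder f g : (\int[cnt]_y (normc (f y * g y))%:E <= L2norm f * L2norm g)%E.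
Proof.
have mR := fun h : tvertex X -> R => @measurable_from_tvertex _ _ setT h.
have h2 : (2^-1 + 2^-1 = 1 :> R) by lra.
have := hoelder cnt (mR (fun y => normc (f y))) (mR (fun y => normc (g y)))
  (ltr0n _ 2) (ltr0n _ 2) h2.
rewrite Lnorm1; apply: le_trans; rewrite le_eqVlt; apply/orP; left; apply/eqP.
by apply: eq_integral => y _; rewrite /= -normcM ger0_norm// normc_ge0.
Qed.

(** Duality: a functional bounded on finitely supported functions is given by a square summable row
    with the same bound. *)
Lemma L2_row_norm (k : tvertex X -> R[i]) (c : R) : 0 <= c ->
  (forall s f, uniq s -> normc (\sum_(y <- s) f y * k y) <= c * norm2 s f) ->
  (L2norm k <= c%:E)%E.
Proof.
move=> c0 kc; apply/L2norm_le => //; apply: integral_counting_le.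
  by move=> y; exact: sqr_ge0.
(* Test [k] against its own conjugate. *)
move=> s us; have := kc s (fun y => conjc (k y)) us.
have -> : norm2 s (fun y => conjc (k y)) = norm2 s k.
  by congr Num.sqrt; apply: eq_bigr => y _; rewrite !sqr_normc; case: (k y) => a b /=; rewrite sqrrN.
have -> : \sum_(y <- s) conjc (k y) * k y = (norm2 s k ^+ 2)%:C.
  rewrite sqr_norm2 rmorph_sum; apply: eq_bigr => y _.
  by rewrite sqr_normc; apply: complex_eq; rewrite ?ReM ?ImM; case: (k y) => a b /=; ring.
rewrite /= expr0n addr0 sqrtr_sqr ger0_norm ?sqr_ge0//.
rewrite -sqr_norm2; have : 0 <= norm2 s k by rewrite sqrtr_ge0.
move: (norm2 s k) => S; rewrite le_eqVlt => /orP[/eqP <- _|Sp].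
  by rewrite expr0n sqr_ge0.
by rewrite expr2 ler_pM2r// => Sc; rewrite -expr2 ler_pXn2r ?nnegrE// ltW.
Qed.

Lemma cintegral_point y : 
  cintegrable cnt setT (fun z => (\1_[set y] z : R)%:C) /\
  cintegral cnt setT (fun z => (\1_[set y] z : R)%:C) = 1.
Proof.
have i1 : (\int[cnt]_z (\1_[set y] z)%:E = 1)%E.
  by rewrite integral_indic// setIT; exact: counting_set1.
split; first split.
- by split; exact: measurable_from_tvertex.
- under eq_integral => z _.
    rewrite (_ : normc _ = \1_[set y] z); last first.
      by rewrite /= expr0n addr0 sqrtr_sqr ger0_norm.
    over.
  by rewrite i1 ltry.
- apply: complex_eq => /=; first by rewrite /Rintegral i1.
  by rewrite Rintegral_cst// mul0r.
Qed.

(** Writing [g] as a combination of point indicators reduces the integral to singletons by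
    linearity. *)
Lemma cintegral_finite_support s (g : tvertex X -> R[i]) : uniq s ->
  (forall y, y \notin s -> g y = 0) -> cintegral cnt setT g = \sum_(y <- s) g y.
Proof.
move=> us g0.
have -> : g = fun z => \sum_(y <- s) g y * (\1_[set y] z : R)%:C.
  apply/funext => z; have [zs|zs] := boolP (z \in s).
    rewrite (bigD1_seq z)//= indicE mem_set// mulr1 big1 ?addr0// => y yz.
    by rewrite indicE memNset ?mulr0//= => zy; rewrite zy eqxx in yz.
  rewrite g0// big_seq big1// => y ys; rewrite indicE memNset ?mulr0//= => zy.
  by rewrite zy ys in zs.
have [_ ->] := cintegral_sum measurableT s g (fun y => (cintegral_point y).1).
under eq_bigr do rewrite (cintegral_point _).2 mulr1.
apply: eq_big_seq => z zs; rewrite (bigD1_seq z)//= indicE mem_set// mulr1 big1 ?addr0// => y yz.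
by rewrite indicE memNset ?mulr0//= => zy; rewrite zy eqxx in yz.
Qed.

(** By duality the row at [x] has norm at most [K |v(x)|], so by Cauchy-Schwarz the matrix acts on
    all of [L^2] and [|T f(x)|] is at most [2 K |v(x)|] times the norm of [f]. Taking the norm in
    [x] brings in that of [v]. *)
Lemma L2_extension (k : tvertex X -> tvertex X -> R[i]) (K : R) (v : tvertex X -> R[i]) :
  0 <= K -> inL2 v ->
  (forall x s f, uniq s ->
    normc (\sum_(y <- s) f y * k x y) <= K * normc (v x) * norm2 s f) ->
  exists T : (tvertex X -> R[i]) -> tvertex X -> R[i],
    [/\ bounded_linear_L2 T,
        forall s f, uniq s -> (forall y, y \notin s -> f y = 0) ->
          forall x, T f x = \sum_(y <- s) f y * k x y
      & (opnormL2 T <= (2 * K)%:E * L2norm v)%E].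
Proof.
move=> K0 vL2 kK; have Kv x : 0 <= K * normc (v x) by rewrite mulr_ge0 ?normc_ge0.
have [nv nv0 nvE] := inL2_norm vL2.
have kL2 x : (L2norm (k x) <= (K * normc (v x))%:E)%E.
  by apply: L2_row_norm => // s f; exact: kK.
have int_le f n x : 0 <= n -> L2norm f = n%:E ->
    (\int[cnt]_y (normc (f y * k x y))%:E <= (n * (K * normc (v x)))%:E)%E.
  move=> n0 fn; apply: le_trans (L2_hoelder f (k x)) _.
  by rewrite fn EFinM; apply: lee_wpmul2l; rewrite ?lee_fin.
have iT f x : inL2 f -> cintegrable cnt setT (fun y => f y * k x y).
  move=> /inL2_norm[n n0 fn]; split; first by split; exact: measurable_from_tvertex.
  by apply: le_lt_trans (int_le f n x n0 fn) _; rewrite ltry.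
pose T f x := cintegral cnt setT (fun y => f y * k x y).
have T_le f n : 0 <= n -> L2norm f = n%:E -> (L2norm (T f) <= (n * (2 * K))%:E * L2norm v)%E.
  move=> n0 fn; apply: L2norm_le_scale => //; first by rewrite !mulr_ge0.
  move=> x; have fL2 : inL2 f by rewrite /inL2 fn ltry.
  rewrite -lee_fin; apply: le_trans (normc_cintegral_le measurableT (iT f x fL2)) _.
  apply: le_trans (lee_wpmul2l _ (int_le f n x n0 fn)) _; first by rewrite lee_fin.
  by rewrite -EFinM lee_fin le_eqVlt; apply/orP; left; apply/eqP; ring.
exists T; split.
- split.
  + move=> f /inL2_norm[n n0 fn]; apply: le_lt_trans (T_le f n n0 fn) _.
    by rewrite nvE -EFinM ltry.
  + move=> a f g fL2 gL2; apply/funext => x; rewrite /T.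
    have -> : (fun y => (a * f y + g y) * k x y) = fun y => a * (f y * k x y) + g y * k x y.
      by apply/funext => y; rewrite mulrDl mulrA.
    rewrite cintegralD ?cintegralZ//; try exact: iT.
    by apply: cintegrableZ => //; exact: iT.
  + exists (2 * K * nv) => f /inL2_norm[n n0 fn]; apply: le_trans (T_le f n n0 fn) _.
    by rewrite fn nvE -!EFinM lee_fin le_eqVlt; apply/orP; left; apply/eqP; ring.
- move=> s f us f0 x; apply: cintegral_finite_support => // y ys.
  by rewrite f0// mul0r.
- apply: ge_ereal_sup => _ [f /= f1 <-].
  have [n n0 fn] : exists2 n : R, 0 <= n & L2norm f = n%:E.
    by apply: inL2_norm; apply: le_lt_trans f1 _; rewrite ltry.
  apply: le_trans (T_le f n n0 fn) _.
  rewrite nvE -!EFinM lee_fin ler_wpM2r//.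
  by rewrite fn lee_fin in f1; rewrite ler_piMl// mulr_ge0.
Qed.

End square_summable.

(** * Finitely supported functions and the extension of the operator *)

Section finite_support.
Context {R : realType} {q : nat} {X : htree q}.

Lemma finitely_supported_seq (f : tvertex X -> R[i]) : finitely_supported f ->
  exists2 s : seq (tvertex X), uniq s & forall y, y \notin s -> f y = 0.
Proof.
move=> ff; exists (fset_set [set x | f x != 0]); first exact: fset_uniq.
move=> y; apply: contraNeq => fy.
by rewrite in_fset_set// mem_set.
Qed.

Lemma helgason_fourier (f : tvertex X -> R[i]) s (w : ray X) (t : R) : uniq s ->
  (forall y, y \notin s -> f y = 0) -> helgason f w t = fourier s f (w, t).
Proof.
move=> us f0; rewrite /fourier fsbig_seq// /helgason; apply/esym/fsbig_widen => // y.
by move=> [_ /= /negP ys]; rewrite f0// mul0r.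
Qed.

End finite_support.

Theorem theorem3p3 (R : realType) (q : nat) (X : htree q)
    (nu : probability (boundary X) R) (hnu : boundary_measure nu)
    (C : R) (hC : 0 < C) :
  exists C' : R,
    forall (sigma : tvertex X * boundary X * R -> R[i]) (v : tvertex X -> R[i]),
      measurable_symbol sigma ->
      inL2 v ->
      (forall x : tvertex X,
        {ae (nu \x @plancherel R q)%E, forall z : boundary X * R,
          phase_space z ->
          normc (cpow q%:R ((2^-1 * height R z.1 x)%:C) * sigma (x, z.1, z.2))
            <= C * normc (v x)}) ->
      (forall (f : tvertex X -> R[i]) (x : tvertex X), finitely_supported f ->
        cintegrable (nu \x @plancherel R q)%E phase_space
          (pdo_integrand sigma f x)) /\
      exists T : (tvertex X -> R[i]) -> tvertex X -> R[i],
        [/\ bounded_linear_L2 T,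
            forall f : tvertex X -> R[i], finitely_supported f ->
              T f = pdo nu sigma f
          & (opnormL2 T <= C'%:E * L2norm v)%E].
Proof.
have [K0 K0_ge0 intF] := integral_fourier_le hnu; pose K := 2 * K0.
have K_ge0 : 0 <= K by rewrite mulr_ge0.
(* Independent of [sigma] and [v]. The factor 2 here and the one in [K] are the losses of
   [normc_cintegral_le], in the sum over vertices and in the phase-space integral. *)
exists (2 * (K * C)) => sigma v msigma vL2 ae_bound.
set m := (nu \x @plancherel R q)%E; set P := @phase_space R q X.
have bound x s f : uniq s ->
    cintegrable m P (fun p => amplitude sigma x p * fourier s f p) /\
    normc (cintegral m P (fun p => amplitude sigma x p * fourier s f p)) <=
      K * C * normc (v x) * norm2 s f.
  rewrite -(mulrA K); apply: amplitude_fourier_bound => //.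
    by rewrite mulr_ge0 ?normc_ge0 ?ltW.
  by apply: filterS (ae_bound x) => p H Pp; rewrite normc_amplitude; exact: H.
have mP : measurable P by exact: measurable_phase_space.
(* The matrix entry: the value at [x] of [T_sigma] on the indicator of [y]. *)
pose k x y := cintegral m P (fun p => amplitude sigma x p * wave y p).
have expand x s f : (fun p => amplitude sigma x p * fourier s f p) =
    fun p => \sum_(y <- s) f y * (amplitude sigma x p * wave y p).
  by apply/funext => p; rewrite mulr_sumr; apply: eq_bigr => y _; rewrite mulrCA.
have iwave x y : cintegrable m P (fun p => amplitude sigma x p * wave y p).
  (* For the one-point list and coefficient 1 the transform is the wave at [y] itself. *)
  have [+ _] := bound x [:: y] (fun=> 1) isT.
  by rewrite (_ : (fun p => amplitude sigma x p * fourier _ _ p) =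
    fun p => amplitude sigma x p * wave y p)//; apply/funext => p; rewrite /fourier big_seq1 mul1r.
have kE x s f : cintegral m P (fun p => amplitude sigma x p * fourier s f p) =
    \sum_(y <- s) f y * k x y.
  rewrite expand.
  by have [_ ->] := cintegral_sum mP s f (iwave x).
have integrandE f s x : uniq s -> (forall y, y \notin s -> f y = 0) ->
    pdo_integrand sigma f x = fun p => amplitude sigma x p * fourier s f p.
  move=> us f0; apply/funext => -[w t]; rewrite /pdo_integrand /=.
  by rewrite (helgason_fourier w t us f0).
split=> [f x /finitely_supported_seq[s us f0]|].
  by rewrite (integrandE f s)//; exact: (bound x s f us).1.
have kK (x : tvertex X) (s : seq (tvertex X)) f : uniq s ->
    normc (\sum_(y <- s) f y * k x y) <= K * C * normc (v x) * norm2 s f.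
  by move=> us; rewrite -kE; exact: (bound x s f us).2.
have [T [bT TE opT]] := L2_extension (mulr_ge0 K_ge0 (ltW hC)) vL2 kK.
exists T; split=> // f /finitely_supported_seq[s us f0].
by apply/funext => x; rewrite (TE s f us f0) /pdo (integrandE f s)// kE.
Qed.
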